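(* There exist absolute constants $C_1,C_2>0$ such that the following holds. For every $0<\beta<\frac15$ there exist $\eta,n_0>0$ such that for every $n\ge n_0$: if $G$ is a $(p,\eta)$-upper-uniform graph on $n$ vertices with $e(G)\ge (1-\beta/2)p\binom n2$ for some $0<p=p(n)\le1$, then for any integer $t$ with $\frac{C_1}{\log(1/\beta)}\cdot\log n\le t\le(1-C_2\beta)n$, $$ex(G,C_t)\le\left(\frac{ex(n,C_t)}{\binom n2}+\beta\right)e(G).$$
   Context: Graphs are finite and simple; $e(G)$ is the number of edges of $G$; $\log$ is the natural logarithm; $C_t$ is the cycle of length $t$ (with $t$ edges). For graphs $G,H$, $ex(G,H)$ is the maximum number of edges in a subgraph of $G$ containing no copy of $H$, and $ex(n,H)=ex(K_n,H)$ is the maximum number of edges in a graph on $n$ vertices containing no copy of $H$ as a (not necessarily induced) subgraph. Upper-uniformity: let $G$ be a graph on $n$ vertices, $0<\eta\le 1$ and $0<p\le 1$. $G$ is $(p,\eta)$-upper-uniform if for all disjoint $U,W\subseteq V(G)$ with $|U|,|W|\ge \eta n$, the number $e_G(U,W)$ of edges between $U$ and $W$ satisfies $e_G(U,W)\le (1+\eta)p|U||W|$. *)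

(* Defs.v *)
From HB Require Import structures.
From mathcomp Require Import all_boot all_order all_algebra.
From mathcomp Require Import reals.

Set Implicit Arguments.
Unset Strict Implicit.
Unset Printing Implicit Defensive.

Import Order.TTheory GRing.Theory Num.Theory.
Local Open Scope ring_scope.

Record sgraph (V : finType) := SGraph {
  edges : {set {set V}};
  edges_card2 : [forall e in edges, #|e| == 2%N]
}.

HB.instance Definition _ (V : finType) := [isSub for @edges V].
HB.instance Definition _ (V : finType) := [Finite of sgraph V by <:].

Definition num_edges (V : finType) (G : sgraph V) : nat := #|edges G|.

Definition adj (V : finType) (G : sgraph V) (x y : V) : bool :=
  [set x; y] \in edges G.

Lemma pairs_card2 (V : finType) (A : {set {set V}}) :
  [forall e in [set e in A | #|e| == 2%N], #|e| == 2%N].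
Proof. by apply/forall_inP => e; rewrite inE => /andP[]. Qed.

Definition complete_graph (n : nat) : sgraph 'I_n :=
  SGraph (pairs_card2 [set: {set 'I_n}]).

(* [ordS i] is i + 1 mod t. For 3 <= t the filter on cardinality removes
   nothing and this is the cycle with t vertices and t edges; it only makes
   the definition total for t < 3. *)
Definition cycle_graph (t : nat) : sgraph 'I_t :=
  SGraph (pairs_card2 [set [set i; ordS i] | i : 'I_t]).

Definition has_copy (V W : finType) (G : sgraph V) (H : sgraph W) : bool :=
  [exists f : {ffun W -> V},
    injectiveb f && [forall x, forall y, adj H x y ==> adj G (f x) (f y)]].

(* Subgraphs of G range over the graphs on the same vertex set whose edges are
   edges of G. *)
Definition ex_graph (V W : finType) (G : sgraph V) (H : sgraph W) : nat :=
  \max_(F : sgraph V | (edges F \subset edges G) && ~~ has_copy F H)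
     num_edges F.

Definition ex_n (W : finType) (n : nat) (H : sgraph W) : nat :=
  ex_graph (complete_graph n) H.

(* For disjoint U and W each edge between them is counted exactly once. *)
Definition edges_between (V : finType) (G : sgraph V) (U W : {set V}) : nat :=
  #|[set xy in setX U W | adj G xy.1 xy.2]|.

Definition upper_uniform (R : realType) (V : finType) (p eta : R)
    (G : sgraph V) : Prop :=
  forall U W : {set V}, [disjoint U & W] ->
    eta * #|V|%:R <= #|U|%:R -> eta * #|V|%:R <= #|W|%:R ->
    (edges_between G U W)%:R <= (1 + eta) * p * #|U|%:R * #|W|%:R.

(* Main.v *)
(* Suppose [F], a subgraph of [G] without a copy of the cycle [C_t], has too many
   edges.

   Reduction. Cut [V] into boundedly many clusters of equal size [m] such that
   almost all pairs of clusters either span no edge of [F] or are joined: all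
   subsets with at least [tau] elements (a small fraction of [m]) span an edge of
   [F]. By upper-uniformity a pair of clusters carries at most about [p m^2]
   edges, so the graph of joined pairs, blown up with slightly shrunk clusters to
   a graph on [V], has more than [ex(n, C_t)] edges. Hence it contains [C_t],
   that is, the reduced graph has a closed walk of length [t] visiting each
   cluster less than about [m] times. No information on the value of
   [ex(n, C_t)] is needed.

   Embedding. Hall's theorem applied to the walk gives at least [t / m] ordered
   pairs [(i, j)] of joined clusters with distinct [i]'s and distinct [j]'s. Each
   carries an alternating path of about [m] vertices (depth-first search), and
   these paths are chained through reserved vertices into one long path [Q]. Two
   trees of logarithmic depth with a common root and large leaf sets then close a
   segment of [Q] of the right length to a cycle of length exactly [t]: the
   beginning of the segment may be moved along a window, so it can be chosen with
   both its ends attached to the leaves. The reduced walk takes care of parity. *)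
Require Import Defs.
From HB Require Import structures.
From mathcomp Require Import all_boot all_order all_algebra.
From mathcomp Require Import reals exp.
From mathcomp Require Import zify ring lra.

Set Implicit Arguments.
Unset Strict Implicit.
Unset Printing Implicit Defensive.

(** * Finite sets and Hall's theorem *)

Section FiniteSets.

Variable T : finType.

Lemma exists_subset_card (A : {set T}) (n : nat) :
  n <= #|A| -> exists2 B : {set T}, B \subset A & #|B| = n.
Proof.
move=> nA; exists [set x in take n (enum A)].
  by apply/subsetP => x; rewrite inE => /mem_take; rewrite mem_enum.
rewrite cardsE (card_uniqP _) ?take_uniq ?enum_uniq // size_take -cardE.
by case: ltngtP nA.
Qed.

Lemma exists_superset_card (A C : {set T}) (n : nat) :
  A \subset C -> #|A| <= n -> n <= #|C| ->
  exists B : {set T}, [/\ A \subset B, B \subset C & #|B| = n].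
Proof.
move=> AC An nC.
have : n - #|A| <= #|C :\: A| by rewrite cardsDS //; lia.
case/exists_subset_card=> B BC cB; exists (A :|: B).
rewrite subsetUl subUset AC (subset_trans BC) ?subsetDl //; split=> //.
rewrite cardsU (_ : A :&: B = set0) ?cards0 ?cB; first by lia.
apply/setP=> x; rewrite !inE; apply/negP=> /andP[xA /(subsetP BC)].
by rewrite inE xA.
Qed.

End FiniteSets.


Section Neighbours.

Variables (L D : finType).
Implicit Types (e : L -> D -> bool) (S : {set L}).

Definition nbrs e S : {set D} := [set y | [exists x in S, e x y]].

Lemma nbrsP e S y :
  reflect (exists2 x, x \in S & e x y) (y \in nbrs e S).
Proof. by rewrite inE; apply: (iffP exists_inP). Qed.

Lemma nbrsU e S S' : nbrs e (S :|: S') = nbrs e S :|: nbrs e S'.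
Proof.
apply/setP=> y; rewrite in_setU; apply/nbrsP/orP.
  by case=> x; rewrite in_setU => /orP[] xS xy; [left|right]; apply/nbrsP; exists x.
by case=> /nbrsP[x xS xy]; exists x => //; rewrite in_setU xS ?orbT.
Qed.

(** Induction on the size of [A]. If some nonempty proper subset [S] is tight, it is matched into
    its own neighbourhood and the rest of [A] into the other vertices; Hall's condition survives
    there because [S] has no more neighbours than elements. If no such subset is tight, any one edge
    can be fixed and its ends removed. [d0] is a default value. *)
Lemma hall (d0 : D) e (A : {set L}) :
  (forall S, S \subset A -> #|S| <= #|nbrs e S|) ->
  exists f : L -> D, {in A, forall x, e x (f x)} /\ {in A &, injective f}.
Proof.
move: {2}#|A| (leqnn #|A|) => n; elim: n A e => [|n IH] A e.
  rewrite leqn0 cards_eq0 => /eqP-> _; exists (fun=> d0).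
  by split=> [x|x y]; rewrite inE.
move=> cA H.
have [/existsP[S /and4P[SA S0 SnA cS]]|tight] :=
  boolP [exists S : {set L}, [&& S \subset A, S != set0, S != A & #|nbrs e S| <= #|S|]].
  have SpA : S \proper A by rewrite properEneq SnA.
  have cSlt : #|S| < #|A| by apply: proper_card.
  have cS0 : 0 < #|S| by rewrite card_gt0.
  have [f1 [f1e f1i]] : exists f : L -> D, {in S, forall x, e x (f x)} /\ {in S &, injective f}.
    by apply: IH => [|S' S'S]; [lia | apply: H; apply: subset_trans SA].
  pose e' x y := e x y && (y \notin nbrs e S).
  have [f2 [f2e f2i]] : exists f : L -> D,
      {in A :\: S, forall x, e' x (f x)} /\ {in A :\: S &, injective f}.
    apply: IH => [|S' S'A]; first by rewrite cardsDS //; lia.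
    have := H (S :|: S'); rewrite subUset SA (subset_trans S'A (subsetDl _ _)).
    move=> /(_ isT); rewrite nbrsU cardsU (_ : S :&: S' = set0) ?cards0; last first.
      apply/setP=> x; rewrite !inE; apply/negP=> /andP[xS /(subsetP S'A)].
      by rewrite inE xS.
    rewrite subn0 => h.
    have : #|nbrs e S :|: nbrs e S'| <= #|nbrs e S| + #|nbrs e' S'|.
      apply: leq_trans (leq_card_setU _ _); apply: subset_leq_card.
      apply/subsetP=> y; rewrite !in_setU; case: (boolP (y \in nbrs e S)) => //= yS.
      by case/nbrsP=> x xS' xy; apply/nbrsP; exists x => //; rewrite /e' xy.
    by lia.
  exists (fun x => if x \in S then f1 x else f2 x); split.
    move=> x xA; case: ifP => xS; first exact: f1e.
    by have /andP[] : e' x (f2 x) by apply: f2e; rewrite inE xS.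
  move=> x y xA yA; case: ifP => xS; case: ifP => yS.
  - exact: f1i.
  - move=> E; have /andP[_ /negP[]] : e' y (f2 y) by apply: f2e; rewrite inE yS.
    by rewrite -E; apply/nbrsP; exists x => //; apply: f1e.
  - move=> E; have /andP[_ /negP[]] : e' x (f2 x) by apply: f2e; rewrite inE xS.
    by rewrite E; apply/nbrsP; exists y => //; apply: f1e.
  - by apply: f2i; rewrite inE ?xS ?yS.
have [->|/set0Pn[x0 x0A]] := eqVneq A set0.
  by exists (fun=> d0); split=> [x|x y]; rewrite inE.
have [y0 x0y0] : exists y0, e x0 y0.
  have := H [set x0]; rewrite sub1set => /(_ x0A); rewrite cards1 card_gt0.
  by case/set0Pn=> y /nbrsP[x]; rewrite inE => /eqP->; exists y.
pose e' x y := e x y && (y != y0).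
have [f2 [f2e f2i]] : exists f : L -> D,
    {in A :\ x0, forall x, e' x (f x)} /\ {in A :\ x0 &, injective f}.
  apply: IH => [|S SA]; first by rewrite (cardsD1 x0 A) x0A in cA; lia.
  have SA' : S \subset A by apply: (subset_trans SA); apply: subsetDl.
  have [->|S0] := eqVneq S set0; first by rewrite cards0.
  move: tight; rewrite negb_exists => /forallP/(_ S); rewrite SA' S0 /= negb_and.
  have -> /= : S != A.
    by apply/eqP=> ES; move/subsetP: SA => /(_ x0); rewrite ES x0A !inE eqxx => /(_ isT).
  rewrite -ltnNge => h.
  have : #|nbrs e S :\ y0| <= #|nbrs e' S|.
    apply/subset_leq_card/subsetP=> y; rewrite !inE => /andP[ny /exists_inP[x xS xy]].
    by apply/exists_inP; exists x => //; rewrite /e' xy.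
  by rewrite (cardsD1 y0 (nbrs e S)) in h; lia.
exists (fun x => if x == x0 then y0 else f2 x); split.
  move=> x xA; case: eqP => [->//|/eqP nx].
  by have /andP[] : e' x (f2 x) by apply: f2e; rewrite !inE nx.
have nf2 x : x \in A -> x != x0 -> f2 x != y0.
  by move=> xA nx; have /andP[] : e' x (f2 x) by apply: f2e; rewrite !inE nx.
move=> x y xA yA; case: eqP => [->|/eqP nx]; case: eqP => [->//|/eqP ny].
- by move=> E; have := nf2 y yA ny; rewrite E eqxx.
- by move=> E; have := nf2 x xA nx; rewrite E eqxx.
- by apply: f2i; rewrite !inE ?nx ?ny.
Qed.

End Neighbours.

(** * Joined pairs and expansion *)

Section Joined.

Variables (V : finType) (e : rel V).
Implicit Types (S U W X Y Z : {set V}).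

Definition has_edge U W := [exists x in U, exists y in W, e x y].

(** A form of regularity without densities. The threshold [tau] is an absolute size, so that the
    property passes unchanged to subsets of [X] and [Y]. *)
Definition joined tau X Y :=
  [forall U : {set V}, forall W : {set V},
    [&& U \subset X, W \subset Y, tau <= #|U| & tau <= #|W|] ==> has_edge U W].

Lemma has_edgeP U W :
  reflect (exists x y, [/\ x \in U, y \in W & e x y]) (has_edge U W).
Proof.
apply: (iffP exists_inP) => [[x xU /exists_inP[y yW xy]]|[x [y [xU yW xy]]]].
  by exists x, y.
by exists x => //; apply/exists_inP; exists y.
Qed.

Lemma joinedP tau X Y :
  reflect (forall U W, U \subset X -> W \subset Y -> tau <= #|U| -> tau <= #|W| ->
             exists x y, [/\ x \in U, y \in W & e x y])
          (joined tau X Y).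
Proof.
apply: (iffP forallP) => [H U W UX WY tU tW|H U].
  by have /forallP/(_ W) := H U; rewrite UX WY tU tW => /has_edgeP.
by apply/forallP=> W; apply/implyP=> /and4P[UX WY tU tW]; apply/has_edgeP; apply: H.
Qed.

Lemma joinedS tau X Y X' Y' :
  X' \subset X -> Y' \subset Y -> joined tau X Y -> joined tau X' Y'.
Proof.
move=> XX YY /joinedP H; apply/joinedP=> U W UX WY; apply: H.
  exact: subset_trans XX.
exact: subset_trans YY.
Qed.

Lemma joined_sym tau X Y : symmetric e -> joined tau X Y -> joined tau Y X.
Proof.
move=> esym /joinedP H; apply/joinedP=> U W UY WX tU tW.
by have [x [y [xW yU xy]]] := H W U WX UY tW tU; exists y, x; rewrite esym.
Qed.

(** The vertices of [Z] without a neighbour in [S] span no edge with [S], so there are fewer than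
    [tau] of them. *)
Lemma joined_nbrs tau X Y S Z :
  joined tau X Y -> S \subset X -> tau <= #|S| -> Z \subset Y ->
  #|Z| < #|Z :&: nbrs e S| + tau.
Proof.
move=> /joinedP J SX tS ZY; rewrite ltnNge; apply/negP=> h.
have t2 : tau <= #|Z :\: nbrs e S|.
  by have := cardsID (nbrs e S) Z; lia.
have [x [y [xS]]] := J S (Z :\: nbrs e S) SX (subset_trans (subsetDl _ _) ZY) tS t2.
by rewrite inE => /andP[/negP yN _] xy; apply: yN; apply/nbrsP; exists x.
Qed.

End Joined.

Section Expander.

Variables (V : finType) (e : rel V) (tau l : nat).
Implicit Types (S U W X Y : {set V}).

(* Maximality of the pair of deleted sets keeps each below [tau], since a pair
   whose left part has [tau] to [2 tau] elements would expand too much. *)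
Lemma joined_expander (Z : bool -> {set V}) :
  0 < tau -> (forall b, joined e tau (Z b) (Z (~~ b))) ->
  (forall b, 2 * l * tau + 4 * tau <= #|Z b|) ->
  exists Z' : bool -> {set V},
    (forall b, Z' b \subset Z b /\ #|Z b| < #|Z' b| + tau) /\
    forall b X, X \subset Z' b -> #|X| <= tau ->
      l * #|X| <= #|nbrs e X :&: Z' (~~ b)|.
Proof.
move=> t0 J cZ.
pose ok (D : {set V} * {set V}) :=
  let d b := if b then D.1 else D.2 in
  [forall b, [&& d b \subset Z b, #|d b| <= 2 * tau &
     #|nbrs e (d b) :&: (Z (~~ b) :\: d (~~ b))| <= l * #|d b|]].
have ok0 : ok (set0, set0).
  apply/forallP=> b; rewrite (_ : (if b then _ else _) = set0); last by case: b.
  rewrite sub0set cards0 /= muln0 leqn0 cards_eq0; apply/eqP/setP=> y.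
  by rewrite !inE; apply/negP=> /andP[/exists_inP[x]]; rewrite inE.
pose D := [arg max_(D > (set0, set0) | ok D) (#|D.1| + #|D.2|)].
have [okD maxD] : ok D /\ forall D', ok D' -> #|D'.1| + #|D'.2| <= #|D.1| + #|D.2|.
  by rewrite /D; case: arg_maxnP => // D1 ? H; split=> // D' /H.
pose d b := if b then D.1 else D.2.
have dP b : [/\ d b \subset Z b, #|d b| <= 2 * tau &
     #|nbrs e (d b) :&: (Z (~~ b) :\: d (~~ b))| <= l * #|d b|].
  by have /forallP/(_ b)/and3P[] := okD.
(* Otherwise the neighbours of [d b] miss fewer than [tau] vertices of the other side, of which at
   least [2 * l * tau + 2 * tau] are not deleted; this contradicts the last condition in [ok]. *)
have dlt b : #|d b| < tau.
  rewrite ltnNge; apply/negP=> h.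
  have [sub c2 cN] := dP b; have [sub' c2' _] := dP (~~ b).
  have := joined_nbrs (J b) sub h (subsetDl (Z (~~ b)) (d (~~ b))).
  rewrite setIC cardsDS //; have := cZ (~~ b).
  have : l * #|d b| <= l * (2 * tau) by rewrite leq_mul2l c2 orbT.
  by lia.
exists (fun b => Z b :\: d b); split.
  move=> b; rewrite subsetDl cardsDS; last by case: (dP b).
  by have := dlt b; have [/subset_leq_card] := dP b; split=> //; lia.
move=> b X XZ cX; rewrite leqNgt; apply/negP=> h.
have [X0|X0] := eqVneq X set0; first by rewrite X0 cards0 muln0 in h.
have dX : [disjoint d b & X].
  rewrite disjoint_sym disjoint_subset; apply/subsetP=> x /(subsetP XZ).
  by rewrite !inE => /andP[].
pose d' c := if c == b then d b :|: X else d c.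
have cdX : #|d b :|: X| = #|d b| + #|X|.
  by rewrite cardsU (disjoint_setI0 dX) cards0 subn0.
have : #|d' true| + #|d' false| <= #|D.1| + #|D.2|.
  apply: (maxD (d' true, d' false)); apply/forallP=> c.
  rewrite (_ : (if c then _ else _) = d' c); last by case: (c).
  rewrite (_ : (if ~~ c then _ else _) = d' (~~ c)); last by case: (c).
  have [sub c2 cN] := dP c; have [subb c2b cNb] := dP b.
  rewrite /d'; have [->|ncb] := eqVneq c b.
    rewrite (_ : (~~ b == b) = false); last by case: (b).
    rewrite subUset subb (subset_trans XZ (subsetDl _ _)) cdX /=.
    have -> /= : #|d b| + #|X| <= 2 * tau by have := dlt b; lia.
    rewrite nbrsU setIUl; apply: leq_trans (leq_card_setU _ _) _.
    by rewrite mulnDr; apply: leq_add => //; apply: ltnW.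
  have -> : ~~ c == b by case: (c) (b) ncb => [] [].
  rewrite sub c2 /=; apply: leq_trans cN; apply/subset_leq_card/setIS.
  have -> : ~~ c = b by case: (c) (b) ncb => [] [].
  by apply: setDS; apply: subsetUl.
have : 0 < #|X| by rewrite card_gt0.
by rewrite /d'; case: (b) cdX; rewrite /= => ->; rewrite /d; lia.
Qed.

End Expander.

(** * Twin trees in an expanding pair *)

Section TwinTrees.

Variables (V : finType) (e : rel V) (tau l : nat).
Implicit Types (S U W X Y : {set V}).
Hypotheses (esym : symmetric e) (eirr : irreflexive e) (l2 : 1 < l) (t0 : 0 < tau).

(* [X] and [Y] are the leaf sets of two disjoint [l]-ary trees of depth [r]
   hanging from two neighbours of a common root. *)
Lemma expander_twin_trees (Z : bool -> {set V}) :
  (forall b, Z b != set0) ->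
  (forall b X, X \subset Z b -> #|X| <= tau ->
     (2 * l + 4) * #|X| <= #|nbrs e X :&: Z (~~ b)|) ->
  forall r b, l ^ r.-1 <= tau ->
  exists X Y U : {set V}, [/\ X \subset Z b, Y \subset Z b, #|X| = l ^ r & #|Y| = l ^ r] /\
    [/\ U \subset Z true :|: Z false, #|U| <= 4 * l ^ r &
     forall x y, x \in X -> y \in Y -> exists p : seq V,
       [/\ path e x p, last x p = y, size p = 2 * r + 2, uniq (x :: p) &
           {subset x :: p <= U}]].
Proof.
move=> Z0 exp r.
have subZ b : Z b \subset Z true :|: Z false.
  by case: b; rewrite ?subsetUl ?subsetUr.
elim: r => [|r IH] b hr.
  have /set0Pn[z zZ] := Z0 (~~ b).
  have := exp (~~ b) [set z]; rewrite sub1set zZ cards1 negbK => /(_ isT t0).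
  rewrite muln1 => cN.
  have /exists_subset_card[S SN cS] : 2 <= #|nbrs e [set z] :&: Z b| by lia.
  have /cards2P[x [y [xny ES]]] : #|S| == 2 by rewrite cS.
  have adjz u : u \in S -> e z u /\ u \in Z b.
    move/(subsetP SN); rewrite inE => /andP[/nbrsP[w]].
    by rewrite inE => /eqP->.
  have [zx xZ] : e z x /\ x \in Z b by apply: adjz; rewrite ES !inE eqxx.
  have [zy yZ] : e z y /\ y \in Z b by apply: adjz; rewrite ES !inE eqxx orbT.
  exists [set x], [set y], [set x; z; y]; split.
    by rewrite !sub1set xZ yZ !cards1.
  split.
  - rewrite !subUset !sub1set (subsetP (subZ b) _ xZ) (subsetP (subZ b) _ yZ).
    by rewrite (subsetP (subZ (~~ b)) _ zZ).
  - rewrite expn0 muln1; apply: leq_trans (leq_card_setU _ _) _.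
    by rewrite cards2 cards1; case: (x != z).
  move=> x' y'; rewrite !inE => /eqP-> /eqP->; exists [:: z; y].
  have neq u v : e u v -> u != v by move=> uv; apply: contraTneq uv => ->; rewrite eirr.
  split=> //=; first by rewrite esym zx zy.
    by rewrite !inE negb_or xny andbT neq ?neq // esym.
  by move=> u; rewrite !inE orbA.
have hr' : l ^ r <= tau by [].
have hr1 : l ^ r.-1 <= tau by apply: leq_trans hr'; rewrite leq_exp2l // leq_pred.
have [X [Y [U [[XZ YZ cX cY] [UZ cU HU]]]]] := IH (~~ b) hr1.
set f := l ^ r in cX cY cU.
have f0 : 0 < f by rewrite expn_gt0; case: (l) l2.
(* Of the [(2 * l + 4) * f] neighbours of either leaf set, at most [4 * f] lie in the old trees [U],
   and the new leaves [X'] take [l * f]; enough remain for [l * f] new leaves of the second tree. *)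
have cNX : (2 * l + 4) * f <= #|nbrs e X :&: Z b|.
  by have := exp _ X XZ; rewrite cX negbK; apply.
have cNY : (2 * l + 4) * f <= #|nbrs e Y :&: Z b|.
  by have := exp _ Y YZ; rewrite cY negbK; apply.
have fl : l ^ r.+1 = l * f by rewrite expnS.
have /exists_subset_card[X' X'N cX'] : l * f <= #|(nbrs e X :&: Z b) :\: U|.
  by have := cardsID U (nbrs e X :&: Z b); have := subset_leq_card (subsetIr (nbrs e X :&: Z b) U); nia.
have /exists_subset_card[Y' Y'N cY'] : l * f <= #|((nbrs e Y :&: Z b) :\: U) :\: X'|.
  have := cardsID U (nbrs e Y :&: Z b); have := subset_leq_card (subsetIr (nbrs e Y :&: Z b) U).
  have := cardsID X' ((nbrs e Y :&: Z b) :\: U).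
  by have := subset_leq_card (subsetIr ((nbrs e Y :&: Z b) :\: U) X'); nia.
have X'P x : x \in X' -> [/\ x \in nbrs e X, x \in Z b & x \notin U].
  by move/(subsetP X'N); rewrite in_setD in_setI => /and3P[].
have Y'P y : y \in Y' -> [/\ y \in nbrs e Y, y \in Z b, y \notin U & y \notin X'].
  by move/(subsetP Y'N); rewrite !in_setD in_setI => /and4P[].
exists X', Y', (U :|: X' :|: Y'); split.
  split; rewrite ?fl //; apply/subsetP=> x.
    by case/X'P.
  by case/Y'P.
split.
- rewrite !subUset UZ; apply/andP; split; apply: subset_trans (subZ b).
    by apply/subsetP=> x /X'P[].
  by apply/subsetP=> x /Y'P[].
- have := leq_of_leqif (leq_card_setU (U :|: X') Y'); have := leq_of_leqif (leq_card_setU U X').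
  have : 2 * f <= l * f by rewrite leq_mul2r l2 orbT.
  by rewrite fl cX' cY'; lia.
move=> x y xX' yY'; have [/nbrsP[x1 x1X x1x] xZ xU] := X'P x xX'.
have [/nbrsP[y1 y1Y y1y] yZ yU yX'] := Y'P y yY'.
have [p [pp lp sp up pU]] := HU x1 y1 x1X y1Y.
exists (rcons (x1 :: p) y); split.
- by rewrite rcons_path /= esym x1x pp /= lp.
- by rewrite last_rcons.
- by rewrite size_rcons /= sp mulnS.
- rewrite cons_uniq rcons_uniq up mem_rcons inE negb_or andbT -andbA.
  apply/and3P; split.
  + by apply: contraNneq yX' => <-.
  + by apply: contra xU; apply: pU.
  + by apply: contra yU; apply: pU.
- move=> u; rewrite in_cons mem_rcons in_cons !in_setU.
  by case/or3P=> [/eqP->|/eqP->|/pU->] //; rewrite ?xX' ?yY' ?orbT.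
Qed.

End TwinTrees.

(** * Long alternating paths by depth-first search *)

Section AlternatingPaths.

Variables (V : finType) (e : rel V) (tau : nat).
Hypothesis esym : symmetric e.
Implicit Types (Z : bool -> {set V}) (s : seq V).

Fixpoint alternates Z b s :=
  if s is x :: s' then (x \in Z b) && alternates Z (~~ b) s' else true.

Lemma alternates_nth Z b s x0 i :
  alternates Z b s -> i < size s -> nth x0 s i \in Z (b (+) odd i).
Proof.
elim: s b i => //= x s IH b [|i] /andP[xb alt]; first by rewrite addbF.
by rewrite ltnS => /(IH _ _ alt); rewrite /= addNb addbN.
Qed.

Lemma alternates_take Z b s i : alternates Z b s -> alternates Z b (take i s).
Proof. by elim: s b i => //= x s IH b [|i] //= /andP[-> /(IH _ i)]. Qed.

Lemma alternates_behead Z b s : alternates Z b s -> alternates Z (~~ b) (behead s).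
Proof. by case: s => //= x s /andP[]. Qed.

Lemma disjoint_sides Z b c x :
  [disjoint Z true & Z false] -> x \in Z b -> x \in Z c -> b = c.
Proof.
move=> dis; case: b c => [] [] // xb xc.
  by rewrite (disjointFr dis xb) in xc.
by rewrite (disjointFr dis xc) in xb.
Qed.

Lemma alternates_count Z b s :
  [disjoint Z true & Z false] -> alternates Z b s ->
  2 * count (mem (Z (~~ b))) s <= size s /\ 2 * count (mem (Z b)) s <= (size s).+1.
Proof.
move=> dis; elim: s b => //= x s IH b /andP[xb /IH[]]; rewrite negbK.
have -> : x \in Z (~~ b) = false.
  by apply/negP=> /(disjoint_sides dis xb); case: (b).
by rewrite xb; lia.
Qed.

(** Depth-first search. No edge ever runs between a dead vertex and an unvisited vertex of opposite
    sides. When the dead vertices of one side first number [tau], fewer than [tau] vertices of the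
    other side are unvisited and at most [tau] are dead. The current path holds the rest of that
    side, hence more than [2 * M - 4 * tau] vertices by alternation. *)
Lemma joined_long_path Z M N :
  [disjoint Z true & Z false] -> 0 < tau <= M ->
  (forall b, joined e tau (Z b) (Z (~~ b))) -> (forall b, M <= #|Z b|) ->
  N + 4 * tau + 2 <= 2 * M ->
  exists s, [/\ size s = N, alternates Z true s, uniq s & sorted e s].
Proof.
move=> dis /andP[t0 tM] J cZ hN.
suff [s [b [ss alts us sos]]] : exists s b,
    [/\ N < size s, alternates Z b s, uniq s & sorted e s].
  case: b alts => alts.
    exists (take N s); rewrite alternates_take ?take_uniq ?take_sorted //.
    by rewrite size_take ss.
  have ss' : N <= size (behead s) by rewrite size_behead; lia.
  exists (take N (behead s)).
  rewrite (alternates_take _ (alternates_behead alts)) take_uniq ?take_sorted //.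
  - by rewrite size_takel.
  - by case: (s) sos => //= x s'; apply: path_sorted.
  - by case: (s) us => //= x s' /andP[].
(* [U] consists of the unvisited vertices and [D] of the dead ones; [s] is the current path with its
   active end at the head. *)
pose inv (U D : {set V}) s b := [/\
  [/\ alternates Z b s, uniq s & sorted e s],
  U \subset Z true :|: Z false,
  {in s, forall x, x \notin U},
  (forall c x, x \in Z c -> [|| x \in D, x \in U | x \in s]) &
  forall c x y, x \in D -> x \in Z c -> y \in U -> y \in Z (~~ c) -> ~~ e x y].
have dlt U D s b : inv U D s b -> forall c, tau <= #|D :&: Z c| ->
    #|D :&: Z (~~ c)| <= tau -> N < size s.
  move=> [[alts us _] UZ sU cov noe] c tD Dt.
  have UZt : #|U :&: Z (~~ c)| < tau.
    rewrite ltnNge; apply/negP=> h; have /joinedP := J c.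
    case/(_ (D :&: Z c) (U :&: Z (~~ c)) (subsetIr _ _) (subsetIr _ _) tD h) => x [y].
    rewrite !inE => -[/andP[xD xc] /andP[yU yc] xy].
    by have := noe c x y xD xc yU yc; rewrite xy.
  have : #|Z (~~ c)| <= #|D :&: Z (~~ c)| + #|U :&: Z (~~ c)| + count (mem (Z (~~ c))) s.
    have Ec : #|[set x in filter (mem (Z (~~ c))) s]| = count (mem (Z (~~ c))) s.
      by rewrite cardsE (card_uniqP (filter_uniq _ us)) size_filter.
    have sub : Z (~~ c) \subset (D :&: Z (~~ c)) :|: (U :&: Z (~~ c)) :|:
        [set x in filter (mem (Z (~~ c))) s].
      apply/subsetP=> x xc; have := cov _ x xc.
      by rewrite !inE mem_filter !inE xc !andbT orbA.
    have := subset_leq_card sub.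
    have := leq_of_leqif (leq_card_setU ((D :&: Z (~~ c)) :|: (U :&: Z (~~ c))) [set x in filter (mem (Z (~~ c))) s]).
    have := leq_of_leqif (leq_card_setU (D :&: Z (~~ c)) (U :&: Z (~~ c))).
    by rewrite Ec; lia.
  have [h1 h2] := alternates_count dis alts; have := cZ (~~ c).
  have : 2 * count (mem (Z (~~ c))) s <= (size s).+1.
    by case: (c) (b) h1 h2 => [] [] /=; lia.
  by lia.
(* Each step moves a vertex from [U] to [s] or from [s] to [D]; both lower [2 * #|U| + size s]. *)
suff main : forall n (U D : {set V}) s b, 2 * #|U| + size s <= n -> inv U D s b ->
    (forall c, #|D :&: Z c| < tau) ->
    exists (U D : {set V}) s b, inv U D s b /\ exists c, tau <= #|D :&: Z c| /\ #|D :&: Z (~~ c)| <= tau.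
  have inv0 : inv (Z true :|: Z false) set0 [::] true.
    split=> // c x; last by rewrite inE.
    by case: c => xc; rewrite !inE xc ?orbT.
  have [|U [D [s [b [I [c [c1 c2]]]]]]] := main _ _ _ _ _ (leqnn _) inv0.
    by move=> c; rewrite set0I cards0.
  have ls := dlt _ _ _ _ I c c1 c2.
  by have [[alts us sos] _ _ _ _] := I; exists s, b; split.
elim=> [|n IH] U D s b hn I small.
  have [[alts _ _] UZ sU cov noe] := I.
  have U0 : U = set0 by apply/eqP; rewrite -cards_eq0; lia.
  have s0 : s = [::] by apply: size0nil; lia.
  have : #|Z true| <= #|D :&: Z true|.
    apply/subset_leq_card/subsetP=> x xZ; have := cov _ x xZ.
    by rewrite U0 s0 !inE xZ !orbF => ->.
  by have := cZ true; have := small true; lia.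
case: s I hn => [|x s] I hn.
  have [[alts _ _] UZ sU cov noe] := I.
  have [U0|/set0Pn[x xU]] := eqVneq U set0.
    have : #|Z true| <= #|D :&: Z true|.
      apply/subset_leq_card/subsetP=> x xZ; have := cov _ x xZ.
      by rewrite U0 !inE xZ !orbF => ->.
    by have := cZ true; have := small true; lia.
  have [c xc] : exists c, x \in Z c.
    by have := subsetP UZ x xU; rewrite inE => /orP[]; [exists true|exists false].
  apply: (IH (U :\ x) D [:: x] c) => //.
    by have := cardsD1 x U; rewrite xU /=; rewrite /= in hn; lia.
  split=> //=; first by rewrite xc.
  - exact: subset_trans (subD1set _ _) UZ.
  - by move=> y; rewrite inE => /eqP->; rewrite !inE eqxx.
  - by move=> c' y /cov; rewrite !inE; case: (y == x); rewrite ?orbT //= orbF.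
  - by move=> c' y z yD yc; rewrite !inE => /andP[_ zU]; apply: noe.
have [[/= /andP[xb alts] /andP[xs us] sos] UZ sU cov noe] := I.
have [/existsP[y /and3P[yU yb xy]]|noy] :=
    boolP [exists y, [&& y \in U, y \in Z (~~ b) & e x y]].
  apply: (IH (U :\ y) D (y :: x :: s) (~~ b)) => //.
    by have := cardsD1 y U; rewrite yU /=; rewrite /= in hn; lia.
  have ys : y \notin x :: s by apply/negP=> /sU; rewrite yU.
  split=> //=.
  - rewrite yb negbK xb alts xs us andbT esym xy; split=> //.
    by rewrite ys.
  - exact: subset_trans (subD1set _ _) UZ.
  - move=> z; rewrite in_cons => /orP[/eqP->|/sU]; first by rewrite !inE eqxx.
    by rewrite !inE negb_and => ->; rewrite orbT.
  - by move=> c z /cov; rewrite !inE; case: (z == y); rewrite ?orbT.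
  - by move=> c w z wD wc; rewrite !inE => /andP[_ zU]; apply: noe.
have I' : inv U (x |: D) s (~~ b).
  split=> //.
  - by split=> //; apply: path_sorted sos.
  - by move=> y ys; apply: sU; rewrite inE ys orbT.
  - move=> c y /cov; rewrite !inE; case: (y == x) => //=.
  - move=> c y z; rewrite !inE => /orP[/eqP->|yD]; last exact: noe.
    move=> xc zU zc; apply: contra noy => xz; apply/existsP; exists z.
    by rewrite zU xz andbT -(disjoint_sides dis xc xb).
have cD c : #|(x |: D) :&: Z c| <= #|D :&: Z c| + (c == b).
  have [->|ncb] := eqVneq c b.
    apply: (@leq_trans #|x |: (D :&: Z b)|).
      apply/subset_leq_card/subsetP=> y; rewrite !inE.
      by case: (y == x).
    by rewrite cardsU1; lia.
  rewrite addn0; apply/subset_leq_card/subsetP=> y; rewrite !inE.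
  case: eqP => [->/= xc|//]; by rewrite (disjoint_sides dis xc xb) eqxx in ncb.
have [h|h] := leqP tau #|(x |: D) :&: Z b|.
  exists U, (x |: D), s, (~~ b); split=> //; exists b; split=> //.
  have := cD (~~ b); have := small (~~ b).
  by rewrite (_ : (~~ b == b) = false); [lia | case: (b)].
apply: (IH U (x |: D) s (~~ b)) => //.
  by rewrite /= in hn; lia.
move=> c; have [->//|ncb] := eqVneq c b.
by have := cD c; rewrite (negbTE ncb) addn0; have := small c; lia.
Qed.

End AlternatingPaths.

(** * Routing through reserved vertices *)

Section DoubleCover.

Variables (I : finType) (R : rel I).

(** The boolean records the parity of the number of steps, so that connectedness here controls walks
    of prescribed parity. *)
Definition double_cover (c c' : I * bool) := R c.1 c'.1 && (c'.2 == ~~ c.2).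

Lemma double_cover_parity c p :
  path double_cover c p -> (last c p).2 = c.2 (+) odd (size p).
Proof.
elim: p c => [|c' p IH] c /=; first by rewrite addbF.
by case/andP=> /andP[_ /eqP c2] /IH ->; rewrite c2 addNb addbN.
Qed.

Lemma connect_flip i j b b' f :
  connect double_cover (i, b) (j, b') -> connect double_cover (i, b (+) f) (j, b' (+) f).
Proof.
case/connectP=> p pp lp; apply/connectP.
exists [seq (c.1, c.2 (+) f) | c <- p].
  rewrite -[(i, b (+) f)]/((i, b).1, (i, b).2 (+) f).
  elim: p (i, b) pp {lp} => //= c p IH c0 /andP[/andP[h1 /eqP h2] /IH h3].
  by rewrite /= h3 andbT /double_cover /= h1 h2 addNb eqxx.
by rewrite (last_map (fun c => (c.1, c.2 (+) f)) p (i, b)) -lp.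
Qed.

Lemma connect_uniq_path c c' :
  connect double_cover c c' ->
  exists p, [/\ path double_cover c p, last c p = c', uniq (c :: p) & size p < 2 * #|I|].
Proof.
case/connectP=> p pp ->; have [p' pp' up' _] := shortenP pp.
exists p'; split=> //.
by have := max_card (mem (c :: p')); rewrite (card_uniqP up') card_prod card_bool mulnC.
Qed.

End DoubleCover.

Section Routing.

Variables (V I : finType) (e : rel V) (R : rel I) (tau : nat).
Variable tag : V -> option (I * nat).

Definition part (i : I) (c : nat) : {set V} := [set x | tag x == Some (i, c)].

(** Parts 2 and 3 are reserved for connections, one part for each sheet of the double cover. *)
Definition route_tag (c : I * bool) := (c.1, 2 + c.2).

Hypothesis J : forall i j c c', R i j -> joined e tau (part i c) (part j c').

(** Induction along the cluster path: at least [2 * tau] vertices of the next reserved part are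
    free, so more than [tau] of them are adjacent to the current set, and they become the new
    starting set. The ends are chosen within [S] and [S'], not prescribed, since joinedness says
    nothing about single vertices. *)
Lemma route (U S' : {set V}) p (c : I * bool) (k' : nat) :
  (forall i b, 2 * tau <= #|part i (2 + nat_of_bool b) :\: U|) ->
  S' \subset part c.1 k' -> tau <= #|S'| ->
  forall (c0 : I * bool) (k : nat) (S : {set V}), path (double_cover R) c0 (rcons p c) ->
    S \subset part c0.1 k -> tau <= #|S| ->
  exists x zs y, [/\ x \in S, y \in S', path e x (rcons zs y),
     map tag zs = [seq Some (route_tag c) | c <- p] & {in zs, forall z, z \notin U}].
Proof.
move=> cY S'P cS'; elim: p => [|c1 p IH] c0 k S /=.
  rewrite andbT => /andP[Rc _] SP cS.
  have /joinedP/(_ S S' SP S'P cS cS')[x [y [xS yS xy]]] := J k k' Rc.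
  by exists x, [::], y; rewrite /= xy.
case/andP=> /andP[Rc _] pp SP cS.
set Y := part c1.1 (2 + c1.2) :\: U.
have h := joined_nbrs (J k (2 + c1.2) Rc) SP cS (subsetDl _ U).
have cY' := cY c1.1 c1.2.
have [||x1 [zs [y [x1S yS' pz tz zU]]]] := IH c1 (2 + c1.2) (Y :&: nbrs e S) pp.
- by apply: subset_trans (subsetIl _ _) (subsetDl _ _).
- by rewrite /Y; lia.
move: x1S; rewrite !inE => /andP[/andP[x1U x1t] /exists_inP[x xS xx1]].
exists x, (x1 :: zs), y; split=> //=; first by rewrite xx1.
  by rewrite tz (eqP x1t).
by move=> z; rewrite inE => /orP[/eqP->//|]; apply: zU.
Qed.

End Routing.

Section EvenPositions.

Variable V : finType.

Lemma even_positions (x0 : V) Z s lo n :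
  alternates Z true s -> uniq s -> ~~ odd lo -> lo + 2 * n <= size s ->
  exists S : {set V}, [/\ S \subset Z true, #|S| = n &
    {in S, forall x, exists i, [/\ ~~ odd i, lo <= i < lo + 2 * n & x = nth x0 s i]}].
Proof.
move=> alt us lo0 hs.
have bd (i : 'I_n) : lo + 2 * i < size s by have := ltn_ord i; lia.
have ev (i : 'I_n) : ~~ odd (lo + 2 * i) by rewrite oddD oddM /= addbF.
exists [set nth x0 s (lo + 2 * i) | i : 'I_n]; split.
- apply/subsetP=> x /imsetP[i _ ->].
  by have := alternates_nth x0 alt (bd i); rewrite (negbTE (ev i)).
- rewrite card_imset ?card_ord // => i j /eqP; rewrite nth_uniq //.
  by move/eqP=> h; apply: val_inj => /=; lia.
- move=> x /imsetP[i _ ->]; exists (lo + 2 * i); split=> //.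
  by have := ltn_ord i; lia.
Qed.

End EvenPositions.

(** * Chaining long paths and closing the cycle *)

(* Cluster [i] contains the disjoint sets [part i c]: 0 and 1 carry the long
   paths (of the pairs [(i, _)] and [(_, i)] respectively), 2 and 3 the connecting
   paths, according to the parity of the step, and 4 the twin trees. *)
Section Phases.

Variables (V I : finType) (e : rel V) (R : rel I) (tau M N : nat).
Variable tag : V -> option (I * nat).
Variables (phases : seq (I * I)) (x0 : V) (ph0 : I * I).

Local Notation part := (part tag).
Local Notation phase n := (nth ph0 phases n).

Hypotheses (esym : symmetric e) (Rsym : symmetric R).
Hypothesis J : forall i j c c', R i j -> joined e tau (part i c) (part j c').
Hypothesis phaseR : {in phases, forall ph, R ph.1 ph.2}.
Hypotheses (phase1 : uniq [seq ph.1 | ph <- phases])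
           (phase2 : uniq [seq ph.2 | ph <- phases]).
Hypothesis phase_conn : {in phases &, forall ph ph', forall b,
  exists b', connect (double_cover R) (ph.2, b) (ph'.1, b')}.
Hypotheses (card_main : forall i c, c < 2 -> M <= #|part i c|)
  (card_route : forall i (b : bool), 2 * tau + size phases <= #|part i (2 + b)|).
Hypotheses (t0 : 0 < tau <= M) (hN : N + 4 * tau + 2 <= 2 * M) (hN4 : 4 * tau <= N)
  (oN : ~~ odd N).

Definition sides (ph : I * I) (b : bool) := if b then part ph.1 0 else part ph.2 1.

Lemma phase_path ph : ph \in phases ->
  exists s, [/\ size s = N, alternates (sides ph) true s, uniq s & sorted e s].
Proof.
move=> phP; apply: (@joined_long_path _ e tau esym _ M) => //.
- by rewrite -setI_eq0 /sides; apply/eqP/setP=> x; rewrite !inE; case: eqP => //= ->; apply/eqP=> -[].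
- case; rewrite /=; first by apply: J; apply: phaseR.
  by apply: J; rewrite Rsym; apply: phaseR.
- by case; apply: card_main.
Qed.

(** What the chain may have touched before pair [n]: main parts of earlier pairs and reserved parts.
    That the next long path is disjoint from it can then be read off from tags alone. *)
Definition old_tag n (q : option (I * nat)) :=
  [|| q \in [seq Some (ph.1, 0) | ph <- take n phases],
      q \in [seq Some (ph.2, 1) | ph <- take n phases] |
      [exists c, q == Some (route_tag c)]].

Lemma old_tagW n n' q : n <= n' -> old_tag n q -> old_tag n' q.
Proof.
move=> nn'; rewrite /old_tag => /or3P[/mapP[ph php ->]|/mapP[ph php ->]|->].
- have -> // : Some (ph.1, 0) \in [seq Some (ph.1, 0) | ph <- take n' phases].
  by apply: map_f; rewrite -(subnKC nn') takeD mem_cat php.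
- have -> // : Some (ph.2, 1) \in [seq Some (ph.2, 1) | ph <- take n' phases].
    by apply: map_f; rewrite -(subnKC nn') takeD mem_cat php.
  by rewrite orbT.
- by rewrite !orbT.
Qed.

Lemma old_tag_phase n : n < size phases ->
  ~~ old_tag n (Some ((phase n).1, 0)) && ~~ old_tag n (Some ((phase n).2, 1)).
Proof.
move=> hn.
have aux (f : I * I -> I) c : uniq (map f phases) ->
    Some (f (phase n), c) \notin [seq Some (f ph, c) | ph <- take n phases].
  move=> uf; apply/negP=> /mapP[ph php [E]].
  have : f (phase n) \in map f (take n phases) by rewrite E map_f.
  have : uniq (map f (take n.+1 phases)) by rewrite map_take take_uniq.
  by rewrite (take_nth ph0 hn) map_rcons rcons_uniq => /andP[/negP].
have aux2 (f : I * I -> I) c i c' : c != c' ->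
    Some (i, c) \notin [seq Some (f ph, c') | ph <- take n phases].
  by move=> cc'; apply/negP=> /mapP[ph _ [_ E]]; rewrite E eqxx in cc'.
have aux3 i c : c < 2 -> ~~ [exists c' : I * bool, Some (i, c) == Some (route_tag c')].
  move=> c2; apply/negP=> /existsP[[j b] /eqP[_ E]].
  by rewrite E in c2.
by rewrite /old_tag !negb_or !aux // !aux2 // !aux3.
Qed.

(* The chained path after [n.+1] pairs: [P] is the long path of the last pair, of
   which only an initial part of length [a] has been cut off. The last condition
   says that the walk traced by [Q0] is consistent with the parity of its length. *)
Definition stage n (Q0 P : seq V) a :=
  let Q := Q0 ++ drop a P in
  [/\ [/\ n < size phases, size P = N, alternates (sides (phase n)) true P,
          ~~ odd a & a < 2 * tau],
      [/\ uniq P, uniq Q & sorted e Q],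
      [/\ {in Q0, forall x, old_tag n (tag x)},
          forall c, count (fun x => tag x == Some (route_tag c)) Q0 <= n &
          (a <= size Q0) && (n * (N - 4 * tau) <= size Q0)],
      forall i, i < N - 2 * tau -> ~~ odd i -> nth x0 Q i \in part (phase 0).1 0 &
      connect (double_cover R) ((phase 0).1, false) ((phase n).1, odd (size Q0))].

Lemma stage0 : 0 < size phases -> exists P, stage 0 [::] P 0.
Proof.
move=> p0; have [P [sP alt uP soP]] := phase_path (mem_nth ph0 p0).
exists P; rewrite /stage /= drop0; split=> //.
- by split=> //; case/andP: t0; lia.
- move=> i hi oi; have hi' : i < size P by rewrite sP; lia.
  by have := alternates_nth x0 alt hi'; rewrite (negbTE oi).
Qed.

Lemma alternates_tag ph s x : alternates (sides ph) true s -> x \in s ->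
  tag x = Some (ph.1, 0) \/ tag x = Some (ph.2, 1).
Proof.
move=> alt xs; have := alternates_nth x alt (ltac:(by rewrite index_mem) : index x s < size s).
by rewrite nth_index //; case: odd; rewrite /= inE => /eqP ->; [right|left].
Qed.

Lemma stage_size n Q0 P a : stage n Q0 P a -> size (Q0 ++ drop a P) = size Q0 + N - a.
Proof. by case=> -[_ sP _ _ ha] _ _ _ _; rewrite size_cat size_drop sP; lia. Qed.

(** Each connection takes at most one vertex of any reserved part and [P] takes none, so the surplus
    [size phases] in [card_route] absorbs all earlier use. *)
Lemma card_routeU n Q0 P a i (b : bool) :
  n <= size phases ->
  (forall c, count (fun x => tag x == Some (route_tag c)) Q0 <= n) ->
  uniq (Q0 ++ drop a P) -> alternates (sides (phase n)) true P ->
  2 * tau <= #|part i (2 + b) :\: [set x in Q0 ++ drop a P]|.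
Proof.
set Q := Q0 ++ drop a P => hn cntQ uQ altP.
have : #|part i (2 + b) :&: [set x in Q]| <= n.
  apply: leq_trans (cntQ (i, b)); rewrite -size_filter.
  rewrite -(card_uniqP (filter_uniq _ _)); last by move: uQ; rewrite cat_uniq => /and3P[].
  apply/subset_leq_card/subsetP=> x; rewrite !inE mem_filter mem_cat.
  case/andP=> /eqP tx /orP[xQ|xP]; first by rewrite /= tx eqxx xQ.
  by have [|] := alternates_tag altP (mem_drop xP); rewrite tx => -[_] //; case: (b).
by move: (cardsID [set x in Q] (part i (2 + b))) (card_route i b) hn; clear; lia.
Qed.

Lemma sorted_rcons_cat s x s' :
  sorted e (rcons s x) -> path e x s' -> sorted e (rcons s x ++ s').
Proof. by case: s => [|z s] //= sos pxs; rewrite cat_path sos last_rcons. Qed.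

(** The last [2 * tau] positions of [P] and the first [2 * tau] positions of the next long path [P']
    each contain [tau] candidates in one cluster. Routing between them picks a vertex [x] where [Q]
    is cut off and a vertex [y] where [P'] is entered. *)
Lemma stageS n Q0 P a : stage n Q0 P a -> n.+1 < size phases ->
  exists Q0' P' a', stage n.+1 Q0' P' a' /\
    size Q0' <= size (Q0 ++ drop a P) + 2 * #|I|.
Proof.
move=> S hn1; have sQ := stage_size S; move: S.
set Q := Q0 ++ drop a P in sQ *.
case=> -[hn sP altP oa ha] [uP uQ soQ] [oldQ cntQ /andP[aQ0 szQ]] firstQ connQ.
have phn : phase n \in phases by apply: mem_nth.
have phn1 : phase n.+1 \in phases by apply: mem_nth.
have [P' [sP' altP' uP' soP']] := phase_path phn1.
set sigma := odd (size Q0) in connQ.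
have [b' /connect_uniq_path[p [pp lp up szp]]] := phase_conn phn phn1 (~~ sigma).
(* Since [a] is even, even positions of [P] appear in [Q] at positions of the parity of
   [size Q0]. *)
have lastP : (forall i, N - 2 * tau <= i < N -> ~~ odd i ->
    exists2 L, (L < size Q) && (size Q0 + N <= L + 2 * tau + a) & nth x0 Q L = nth x0 P i /\ odd L = sigma).
  move=> i hi oi; have ai : a <= i by clear -hi ha hN4; lia.
  exists (size Q0 + (i - a)); first by rewrite sQ; clear -hi ha hN4; lia.
  split; last by rewrite oddD -/sigma oddB // (negbTE oi) (negbTE oa) !addbF.
  by rewrite nth_cat ltnNge leq_addr /= addKn nth_drop subnKC.
have [S [SA cS Spos]] : exists S : {set V}, [/\ S \subset part (phase n).1 0, #|S| = tau &
    {in S, forall x, exists i, [/\ ~~ odd i, N - 2 * tau <= i < N & x = nth x0 P i]}].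
  have lo_even : ~~ odd (N - 2 * tau).
    by rewrite oddB ?oddM ?addbF //; clear -hN4; lia.
  have lo_le : N - 2 * tau + 2 * tau <= size P by rewrite sP subnK //; clear -hN4; lia.
  have [S [S1 S2 S3]] := even_positions x0 altP uP lo_even lo_le.
  exists S; split=> // x /S3[i [oi hi ->]]; exists i; split=> //; clear -hi hN4; lia.
have le0 : 0 + 2 * tau <= size P' by rewrite sP'; clear -hN4; lia.
have [S' [S'A cS' S'pos]] := even_positions x0 altP' uP' (isT : ~~ odd 0) le0.
have cYU (i : I) (b : bool) : 2 * tau <= #|part i (2 + b) :\: [set x in Q]|.
  exact: card_routeU (ltnW hn) cntQ uQ altP.
(* The connection first steps over to the partner cluster [(phase n).2] and then follows [p], whose
   end is represented by [S'] instead of a reserved vertex. *)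
have pp2 : path (double_cover R) ((phase n).1, sigma) (((phase n).2, ~~ sigma) :: p).
  by rewrite /= pp andbT /double_cover /= eqxx andbT phaseR.
rewrite lastI lp in pp2.
have S'B : S' \subset part ((phase n.+1).1, b').1 0 := S'A.
have [x [zs [y [xS yS pzs tzs zsU]]]] :=
  route J cYU S'B (eq_leq (Logic.eq_sym cS')) pp2 SA (eq_leq (Logic.eq_sym cS)).
have [i [oi hi Ex]] := Spos x xS; have [a' [oa' ha' Ey]] := S'pos y yS.
have [L /andP[LQ hL] [EL oL]] := lastP i hi oi; rewrite -Ex in EL.
have szs : size zs = size p by rewrite -(size_map tag) tzs size_map size_belast.
exists (take L.+1 Q ++ zs), P', a'; split; last first.
  by rewrite size_cat szs size_takel //; move: (ltnW szp) LQ; clear; lia.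
have sT : size (take L.+1 Q) = L.+1 by rewrite size_takel.
have tQ z : z \in take L.+1 Q -> old_tag n.+1 (tag z).
  move/mem_take; rewrite mem_cat => /orP[/oldQ/old_tagW->//|/mem_drop zP].
  rewrite /old_tag (take_nth ph0 hn) !map_rcons !mem_rcons !inE.
  by have [->|->] := alternates_tag altP zP; rewrite eqxx ?orbT.
have tzsY z : z \in zs -> exists c, tag z = Some (route_tag c).
  by move/(map_f tag); rewrite tzs => /mapP[c _ ->]; exists c.
have utzs : uniq (map tag zs).
  rewrite tzs map_inj_uniq; first by move: up; rewrite lastI rcons_uniq => /andP[].
  by move=> [i1 b1] [i2 b2] [-> /eqP]; case: b1 b2 => [] [].
have uzs := map_uniq utzs.
have newP z : z \in P' -> ~~ old_tag n.+1 (tag z).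
  move=> zP; have /andP[h1 h2] := old_tag_phase hn1.
  by have [->|->] := alternates_tag altP' zP.
rewrite /stage -catA; split.
- by split=> //; case/andP: ha'.
- split=> //.
  + rewrite !cat_uniq take_uniq // uzs drop_uniq // andbT /= has_cat negb_or -andbA.
    apply/and3P; split.
    * apply/hasPn=> z /zsU; apply: contra => /mem_take.
      by rewrite inE.
    * by apply/hasPn=> z /mem_drop/newP; apply: contra => /tQ.
    * apply/hasPn=> z /mem_drop/newP; apply: contra => /tzsY[c ->].
      by rewrite /old_tag; apply/or3P; constructor 3; apply/existsP; exists c.
  + have drE : drop a' P' = y :: drop a'.+1 P' by rewrite (drop_nth x0) ?sP' ?Ey //; move: ha' hN4; clear; lia.
    have soT : sorted e (take L.+1 Q) by apply: take_sorted.
    have lT : exists T, take L.+1 Q = rcons T x.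
      by exists (take L Q); rewrite (take_nth x0) // EL.
    have [T ET] := lT; rewrite ET in soT *.
    have soD : sorted e (y :: drop a'.+1 P') by rewrite -drE; apply: drop_sorted.
    by apply: sorted_rcons_cat => //; rewrite drE -cat_rcons cat_path pzs last_rcons.
- split.
  + move=> z; rewrite mem_cat => /orP[/tQ//|/tzsY[c ->]].
    by rewrite /old_tag; apply/or3P; constructor 3; apply/existsP; exists c.
  + move=> c; rewrite count_cat -[n.+1]addn1; apply: leq_add.
      apply: leq_trans (cntQ c).
      apply: (@leq_trans (count (fun x => tag x == Some (route_tag c)) Q)).
        by rewrite -[X in _ <= count _ X](cat_take_drop L.+1) count_cat leq_addr.
      rewrite count_cat -[leqRHS]addn0 leq_add2l leqNgt -has_count.
      apply/hasPn=> z /mem_drop zP.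
      by have [->|->] := alternates_tag altP zP; apply/eqP=> -[_]; case: (c.2).
    by rewrite -(@count_map _ _ tag (pred1 (Some (route_tag c)))) count_uniq_mem // leq_b1.
  (* Fewer than [2 * tau] vertices of [P] are lost at either end, whence the gain of [N - 4 * tau]
     per pair. *)
  + by rewrite size_cat sT mulSn; move: szQ hL ha hN4 aQ0 ha'; clear; lia.
- move=> k hk ok; have kL : k < L.+1 by move: hk hL aQ0; clear; lia.
  rewrite nth_cat sT kL nth_take //; exact: firstQ.
- apply: connect_trans connQ _; apply/connectP.
  have := pp2; rewrite -lp -lastI => pp3; exists (((phase n).2, ~~ sigma) :: p) => //.
  rewrite /= lp size_cat sT szs; congr (_, _).
  have := double_cover_parity pp; rewrite lp /= => ->.
  by rewrite oddD /= oL addNb.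
Qed.

(** Stop at the first stage whose path reaches [goal]. Before the last extension the path was
    shorter, so [Q0] exceeds [goal] by at most the length of one connection. *)
Lemma good_stage goal :
  0 < size phases -> goal <= size phases * (N - 4 * tau) ->
  exists n Q0 P a, [/\ stage n Q0 P a, size Q0 <= goal + 2 * #|I| &
    goal <= size (Q0 ++ drop a P)].
Proof.
move=> p0 hgoal.
suff main n : n < size phases ->
    (exists n Q0 P a, [/\ stage n Q0 P a, size Q0 <= goal + 2 * #|I| &
      goal <= size (Q0 ++ drop a P)]) \/
    (exists Q0 P a, stage n Q0 P a /\ size Q0 <= goal + 2 * #|I|).
  have [|//|[Q0 [P [a [S hS]]]]] := main (size phases).-1; first by rewrite prednK.
  exists (size phases).-1, Q0, P, a; split=> //.
  rewrite (stage_size S); case: S => -[_ _ _ _ ha] _ [_ _ /andP[_ szQ]] _ _.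
  have := hgoal; rewrite -[X in X * _](prednK p0) mulSn.
  by move: szQ ha hN4; clear; lia.
elim: n => [|n IH] hn.
  by right; have [P S] := stage0 hn; exists [::], P, 0.
have [|[Q0 [P [a [S hS]]]]] := IH (ltnW hn); first by left.
have [h|h] := leqP goal (size (Q0 ++ drop a P)); first by left; exists n, Q0, P, a.
right; have [Q0' [P' [a' [S' hS']]]] := stageS S hn.
by exists Q0', P', a'; split=> //; move: hS' h; clear; lia.
Qed.

(** * Closing the chained path to a cycle of prescribed length *)

Variables (l r t : nat).
Hypotheses (eirr : irreflexive e) (l2 : 1 < l) (lr : l ^ r.-1 <= tau <= l ^ r).
Hypothesis card_tree : forall i, 2 * (2 * l + 4) * tau + 4 * tau <= #|part i 4|.
Hypotheses (phases0 : 0 < size phases) (ht : 2 * r + 4 + 2 * #|I| <= t)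
  (hcap : t + 4 * tau + 2 <= size phases * (N - 4 * tau))
  (hwin : 8 * tau + 4 * #|I| + 8 <= N - 2 * tau)
  (hclosed : connect (double_cover R) ((phase 0).1, false) ((phase 0).1, odd t)).

(** The trees grow in the parts 4 of the two clusters of the first pair. Both leaf sets lie in
    [(phase 0).2] and have at least [tau] vertices, so either is attached to all but fewer than
    [tau] vertices of any set in a joined cluster. *)
Lemma twin_leaves : exists X Y : {set V},
  [/\ X \subset part (phase 0).2 4, Y \subset part (phase 0).2 4, tau <= #|X|, tau <= #|Y| &
   forall x y, x \in X -> y \in Y -> exists p,
     [/\ path e x p, last x p = y, size p = 2 * r + 2, uniq (x :: p) &
       {in x :: p, forall z, exists i, tag z = Some (i, 4)}]].
Proof.
pose Z b := if b then part (phase 0).2 4 else part (phase 0).1 4.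
have ph : R (phase 0).1 (phase 0).2 by apply/phaseR/mem_nth.
have tau0 : 0 < tau by case/andP: t0.
have [|b|Z' [Z'Z expZ]] := @joined_expander V e tau (2 * l + 4) Z tau0.
- by case; apply: J; rewrite // Rsym.
- by case: b; apply: card_tree.
have [|||X [Y [U [[XZ YZ cX cY] [UZ _ HU]]]]] :=
  @expander_twin_trees V e tau l esym eirr l2 tau0 Z' _ _ r true.
- move=> b; rewrite -card_gt0; have [_] := Z'Z b; have := card_tree (phase 0).2.
  have := card_tree (phase 0).1; move: tau0; rewrite /Z; case: b; clear; nia.
- exact: expZ.
- by case/andP: lr.
exists X, Y; rewrite cX cY; case/andP: lr => _ ->.
have sub := (Z'Z true).1; split=> //; try exact: subset_trans sub.
move=> x y xX yY; have [p [pp lp sp up pU]] := HU x y xX yY.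
exists p; split=> // z /pU/(subsetP UZ); rewrite inE.
by case/orP=> /(subsetP (Z'Z _).1); rewrite inE => /eqP ->; eexists.
Qed.

(** The cycle consists of a segment of [Q] with [s + 1] vertices, a connection of [size p] vertices
    from its end to a leaf in [L1], and a tree path of [2 * r + 3] vertices to a leaf in [L2]
    adjacent to the start of the segment. Sliding the segment over [2 * tau] even offsets makes both
    attachments possible at once. *)
Lemma phases_cycle : exists C, [/\ size C = t, uniq C & cycle e C].
Proof.
have tau0 : 0 < tau by case/andP: t0.
have [L1 [L2 [L1P L2P cL1 cL2 tree]]] := twin_leaves.
(* The extra [4 * tau + 2] leaves room for sliding the segment and for rounding to even
   positions. *)
have hgoal : t - (2 * r + 4) + (4 * tau + 2) <= size phases * (N - 4 * tau).
  by apply: leq_trans hcap; clear; lia.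
have [n [Q0 [P [a [S hQ0 hQ]]]]] := good_stage phases0 hgoal.
have sQ := stage_size S; move: S.
set Q := Q0 ++ drop a P in sQ hQ *.
case=> -[hn sP altP oa ha] [uP uQ soQ] [oldQ cntQ /andP[aQ0 szQ]] firstQ connQ.
have phR0 : R (phase 0).1 (phase 0).2 by apply/phaseR/mem_nth.
(* With this parity of [p] the segment ends at a position of the parity of [size Q0], that is, at an
   even position of [P]. *)
pose b := odd (size Q0) (+) odd t.
have : connect (double_cover R) ((phase 0).1, false) ((phase n).1, b).
  apply: connect_trans hclosed _; rewrite -[odd t]addFb.
  exact: connect_flip.
case/connect_uniq_path=> p [pp lp up szp].
have parp : odd (size p) = b by have := double_cover_parity pp; rewrite lp.
set s := t - (2 * r + 4) - size p.
have es : odd s = odd (size Q0).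
  rewrite /s !oddB; [|by move: ht; clear; lia|by move: ht szp; clear; lia].
  by rewrite parp /b oddD oddM /= addbF; case: (odd t); case: odd.
(* The least even start for which the end of the segment lies beyond [Q0]. *)
pose al := (size Q0 - s) + odd (size Q0 - s).
have alev : ~~ odd al by rewrite oddD; case: (odd (_ - _)).
have win (i : 'I_(2 * tau)) : al + 2 * i < N - 2 * tau.
  move: (ltn_ord i) (leq_b1 (odd (size Q0 - s))) hQ0 hwin szp ht; rewrite /al /s; clear; lia.
have win2 (i : 'I_(2 * tau)) : size Q0 <= al + 2 * i + s < size Q.
  move: (ltn_ord i) (leq_b1 (odd (size Q0 - s))) hQ sQ hQ0 hwin szp ht ha; rewrite /al /s; clear; lia.
have st : s + size p + (2 * r + 4) = t by move: szp ht; rewrite /s; clear; lia.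
clearbody al s.
have posA (i : 'I_(2 * tau)) : nth x0 Q (al + 2 * i) \in part (phase 0).1 0.
  by apply: firstQ; rewrite ?win // oddD oddM addbF.
have posB (i : 'I_(2 * tau)) : nth x0 Q (al + 2 * i + s) \in part (phase n).1 0.
  have /andP[h1 h2] := win2 i.
  rewrite nth_cat ltnNge h1 /= nth_drop.
  have hP : a + (al + 2 * i + s - size Q0) < size P.
    by rewrite sP; move: h1 h2 sQ ha hN4; clear; lia.
  have := alternates_nth x0 altP hP; rewrite oddD oddB // (oddD _ s) (oddD al) oddM.
  by rewrite (negbTE oa) (negbTE alev) es /= addbb.
have cA : tau <= #|[set i : 'I_(2 * tau) | nth x0 Q (al + 2 * i) \in nbrs e L2]|.
  pose A := [set nth x0 Q (al + 2 * nat_of_ord i) | i : 'I_(2 * tau)].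
  have injA : injective (fun i : 'I_(2 * tau) => nth x0 Q (al + 2 * nat_of_ord i)).
    move=> i j /eqP; rewrite nth_uniq //.
    + by move/eqP=> h; apply: val_inj => /=; move: h; clear; lia.
    + by have /andP[_] := win2 i; apply: leq_ltn_trans; apply: leq_addr.
    + by have /andP[_] := win2 j; apply: leq_ltn_trans; apply: leq_addr.
  have AP : A \subset part (phase 0).1 0 by apply/subsetP=> x /imsetP[i _ ->].
  have := joined_nbrs (J 4 0 (ltac:(rewrite Rsym; exact: phR0) : R (phase 0).2 (phase 0).1)) L2P cL2 AP.
  rewrite card_imset // card_ord.
  have -> : A :&: nbrs e L2 = [set nth x0 Q (al + 2 * nat_of_ord i) |
      i in [set i : 'I_(2 * tau) | nth x0 Q (al + 2 * i) \in nbrs e L2]].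
    apply/setP=> x; rewrite inE; apply/andP/imsetP.
      by case=> /imsetP[i _ ->] xN; exists i => //; rewrite in_set.
    by case=> i; rewrite in_set => iN ->; split=> //; apply/imsetP; exists i.
  by rewrite card_imset //; clear; lia.
set good := [set i : 'I_(2 * tau) | _] in cA.
pose S' := [set nth x0 Q (al + 2 * nat_of_ord i + s) | i in good].
have S'P : S' \subset part ((phase n).1, b).1 0 by apply/subsetP=> x /imsetP[i _ ->].
have cS' : tau <= #|S'|.
  rewrite card_imset // => i j /eqP; rewrite nth_uniq //.
  + by move/eqP=> h; apply: val_inj => /=; move: h; clear; lia.
  + by case/andP: (win2 i).
  + by case/andP: (win2 j).
have cYU (i : I) (c : bool) : 2 * tau <= #|part i (2 + c) :\: [set x in Q]|.
  by apply: card_routeU (ltnW hn) cntQ uQ altP.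
have pp2 : path (double_cover R) ((phase 0).2, true) (((phase 0).1, false) :: p).
  by rewrite /= pp andbT /double_cover /= eqxx andbT Rsym.
rewrite lastI lp in pp2.
have [x [zs [y [xL1 yS' pzs tzs zsU]]]] := route J cYU S'P cS' pp2 L1P cL1.
have szs : size zs = size p by rewrite -(size_map tag) tzs size_map size_belast.
have [i ig Ey] := imsetP yS'; move: ig; rewrite in_set => /nbrsP[x' x'L2 x'Q].
have [q [pq lq sq uq qT]] := tree x x' xL1 x'L2.
have /andP[h1 h2] := win2 i.
set A := drop (al + 2 * i) Q.
have sA : size A = size Q - (al + 2 * i) by rewrite size_drop.
have A0 : take s.+1 A = nth x0 Q (al + 2 * i) :: take s (drop (al + 2 * i).+1 Q).
  by rewrite /A (drop_nth x0) //; move: h2; clear; lia.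
have sT : size (take s.+1 A) = s.+1 by rewrite size_takel // sA; move: h2; clear; lia.
have lA : last y (take s.+1 A) = y.
  by rewrite (last_nth x0) sT /= nth_take // /A nth_drop -Ey.
exists (take s.+1 A ++ rev zs ++ (x :: q)); split.
- by rewrite !size_cat sT size_rev szs /= sq; move: st; clear; lia.
- have tQ z : z \in take s.+1 A -> z \in Q by move/mem_take/mem_drop.
  have tagQ z : z \in Q -> forall i, tag z != Some (i, 4).
    rewrite mem_cat => /orP[/oldQ/or3P[/mapP[? _ ->]|/mapP[? _ ->]|/existsP[[i' c'] /eqP->]]|/mem_drop zP] i'';
      try by apply/eqP=> -[].
      by case: c'; apply/eqP=> -[].
    by have [->|->] := alternates_tag altP zP; apply/eqP=> -[].
  rewrite !cat_uniq rev_uniq uq (_ : uniq (take _ _)); last by rewrite take_uniq ?drop_uniq.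
  rewrite (_ : uniq zs); last first.
    apply: (@map_uniq _ _ tag); rewrite tzs map_inj_uniq.
      by move: up; rewrite lastI rcons_uniq => /andP[].
    by move=> [i1 b1] [i2 b2] [-> /eqP]; case: b1 b2 => [] [].
  rewrite has_cat negb_or andbT !andTb -!andbA; apply/and3P; split.
  + by apply/hasPn=> z; rewrite mem_rev => /zsU; apply: contra => /tQ; rewrite inE.
  + by apply/hasPn=> z /qT[i' Ez]; apply/negP=> /tQ/tagQ/(_ i'); rewrite Ez eqxx.
  + apply/hasPn=> z /qT[i' Ez]; apply/negP; rewrite /= mem_rev => /(map_f tag).
    by rewrite tzs Ez => /mapP[[i1 b1] _]; case: b1.
- have soT : sorted e (take s.+1 A) by rewrite take_sorted ?drop_sorted.
  have pyx : path e y (rcons (rev zs) x).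
    have := rev_path e x (rcons zs y); rewrite last_rcons belast_rcons rev_cons => ->.
    by rewrite (eq_path (e' := e)) // => u v; rewrite esym.
  move: soT lA; rewrite A0 /= => soT lA.
  rewrite rcons_cat cat_path soT lA /= rcons_cat -cat_rcons cat_path pyx last_rcons /=.
  by rewrite rcons_path pq lq.
Qed.

End Phases.

(** * From closed walks to cycles *)

Lemma card_index_range (T : finType) (A : {set T}) lo hi :
  hi <= #|A| -> hi - lo <= #|[set x in A | lo <= index x (enum A) < hi]|.
Proof.
move=> hA; have [A0|[x0 _]] := set_0Vmem A; first by move: hA; rewrite A0 cards0; clear; lia.
have bd (i : 'I_(hi - lo)) : lo + i < size (enum A).
  by rewrite -cardE; move: (ltn_ord i) hA; clear; lia.
have inj : injective (fun i : 'I_(hi - lo) => nth x0 (enum A) (lo + i)).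
  by move=> i j /eqP; rewrite nth_uniq ?enum_uniq // eqn_add2l => /eqP/val_inj.
rewrite -[X in X <= _](card_ord (hi - lo)) -(card_imset _ inj).
apply/subset_leq_card/subsetP=> x /imsetP[i _ ->].
rewrite inE -mem_enum mem_nth //= index_uniq ?enum_uniq // leq_addr /=.
by move: (ltn_ord i); clear; lia.
Qed.

Section ClosedWalks.

Variables (I : finType) (R : rel I) (t : nat) (c : 'I_t -> I).
Hypothesis cR : forall a, R (c a) (c (ordS a)).

Lemma val_iter_ordS n (a : 'I_t) : val (iter n (@ordS t) a) = (a + n) %% t.
Proof.
elim: n => [|n IH] /=; first by rewrite addn0 modn_small.
by rewrite IH -addn1 modnDml addn1 addnS.
Qed.

Lemma walk_connect n a b :
  connect (double_cover R) (c a, b) (c (iter n (@ordS t) a), b (+) odd n).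
Proof.
elim: n => [|n IH]; first by rewrite addbF connect0.
apply: connect_trans IH (connect1 _).
by rewrite /double_cover /= cR /= addbN eqxx.
Qed.

Lemma walk_connect_any a a' b : exists b', connect (double_cover R) (c a, b) (c a', b').
Proof.
exists (b (+) odd (t + a' - a)).
suff E : iter (t + a' - a) (@ordS t) a = a' by have := walk_connect (t + a' - a) a b; rewrite E.
apply: val_inj; rewrite val_iter_ordS subnKC; last by have := ltn_ord a; clear; lia.
by rewrite modnDl modn_small.
Qed.

Lemma walk_connect_closed a : connect (double_cover R) (c a, false) (c a, odd t).
Proof.
have := walk_connect t a false; rewrite (_ : iter t _ a = a) //.
by apply: val_inj; rewrite val_iter_ordS modnDr modn_small.
Qed.

(* Hall's theorem in the bipartite double cover, with dummy vertices absorbing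
   the deficiency. *)
Lemma walk_matching D : 0 < t -> 0 < D -> (forall i, #|[set a | c a == i]| <= D) ->
  exists phases : seq (I * I), [/\ t <= size phases * D, size phases <= #|I|,
    uniq [seq ph.1 | ph <- phases], uniq [seq ph.2 | ph <- phases] &
    {in phases, forall ph, exists a, ph = (c a, c (ordS a))}].
Proof.
move=> t0 D0 cD.
(* [q] is [t / D] rounded up. With [delta] dummy partners all clusters can be matched, and at least
   [q] of them receive a genuine partner. *)
pose q := (t.-1 %/ D).+1.
pose delta := #|I| - q.
pose E i (y : I + 'I_delta) := if y is inl j then [exists a, (c a == i) && (c (ordS a) == j)] else true.
have vis (S : {set I}) : #|[set a | c a \in S]| <= #|S| * D.
  rewrite -sum1_card (partition_big c (mem S)) /=; last by move=> a; rewrite inE.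
  rewrite -sum_nat_const; apply: leq_sum => i iS.
  apply: leq_trans (cD i); rewrite -sum1_card; apply: eq_leq; apply: eq_bigl => a.
  by rewrite !inE; case: eqP => [->|]; rewrite ?iS ?andbF.
pose N (S : {set I}) := [set c (ordS a) | a in [set a | c a \in S]].
(* Of the [t] positions, those in [S] step into [N S] and the others lie outside [S]; each cluster
   accounts for at most [D] positions. *)
have visN (S : {set I}) : t <= (#|N S| + (#|I| - #|S|)) * D.
  have : #|[set a | c a \in S]| <= #|[set a | c a \in N S]|.
    rewrite -(card_imset (mem [set a | c a \in S]) (bij_inj (@ordS_bij t))).
    apply/subset_leq_card/subsetP=> a' /imsetP[a aS ->]; rewrite inE.
    by apply/imsetP; exists a.
  have : #|[set a | c a \in S]| + #|[set a | c a \in ~: S]| = t.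
    rewrite -[RHS]card_ord -(cardsC [set a | c a \in S]); congr (_ + #|pred_of_set _|).
    by apply/setP=> a; rewrite !inE.
  have := vis (N S); have := vis (~: S); have := cardsC S.
  have := max_card (mem S); clear; nia.
have qI : q <= #|I|.
  rewrite /q ltn_divLR //; have := visN [set: I].
  rewrite cardsT subnn addn0 prednK // => /leq_trans; apply.
  by rewrite leq_mul2r max_card orbT.
have hall_cond (S : {set I}) : S \subset [set: I] -> #|S| <= #|nbrs E S|.
  move=> _; have [->|[i0 i0S]] := set_0Vmem S; first by rewrite cards0.
  have sub : inl @: N S :|: inr @: [set: 'I_delta] \subset nbrs E S.
    apply/subsetP=> y; rewrite in_setU => /orP[/imsetP[j /imsetP[a aS ->] ->]|/imsetP[d _ ->]].
      rewrite inE in aS; apply/nbrsP; exists (c a) => //=.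
      by apply/existsP; exists a; rewrite !eqxx.
    by apply/nbrsP; exists i0.
  have := subset_leq_card sub; rewrite cardsU (_ : _ :&: _ = set0); last first.
    by apply/setP=> y; rewrite in_setI in_set0; apply/negP=> /andP[/imsetP[j _ ->]] /imsetP[d _].
  have inlI : injective (@inl I 'I_delta) by move=> ? ? [].
  have inrI : injective (@inr I 'I_delta) by move=> ? ? [].
  rewrite cards0 subn0 (card_imset _ inlI) (card_imset _ inrI) cardsT card_ord.
  apply: leq_trans.
  have : q <= #|N S| + (#|I| - #|S|).
    by rewrite /q ltn_divLR //; have := visN S; move: t0; clear; lia.
  have : #|S| <= #|I| := max_card _.
  by rewrite /delta; move: qI; clear; lia.
have a0 : 'I_t by exists 0.
have [f [fE finj]] := hall (inl (c a0)) hall_cond.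
pose A := [set i | if f i is inl _ then true else false].
pose g i := if f i is inl j then j else i.
have fA i : i \in A -> f i = inl (g i) by rewrite inE /g; case: (f i).
have cA : q <= #|A|.
  have : #|~: A| <= delta.
    rewrite -[leqRHS]card_ord -(cardsT 'I_delta).
    rewrite -(card_imset _ (_ : injective (@inr I 'I_delta))); last by move=> ? ? [].
    rewrite -(card_in_imset (f := f)); last by move=> x y _ _; apply: finj; rewrite inE.
    apply/subset_leq_card/subsetP=> y /imsetP[i]; rewrite !inE => iA ->.
    by case: (f i) iA => // d _; apply/imsetP; exists d.
  by have := cardsC A; rewrite /delta; move: qI; clear; lia.
exists [seq (i, g i) | i <- enum A]; split.
- rewrite size_map -cardE; apply: (@leq_trans (q * D)); last by rewrite leq_mul2r cA orbT.
  by have := ltn_ceil t.-1 D0; rewrite -/q; clear; lia.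
- by rewrite size_map -cardE max_card.
- by rewrite -map_comp map_id enum_uniq.
- rewrite -map_comp map_inj_in_uniq ?enum_uniq // => i j.
  rewrite !mem_enum => iA jA /= gij; apply: finj; rewrite ?inE //.
  by rewrite !fA // gij.
- move=> ph /mapP[i]; rewrite mem_enum => iA ->.
  have := fE i (in_setT i); rewrite fA //= => /existsP[a /andP[/eqP <- /eqP <-]].
  by exists a.
Qed.

End ClosedWalks.

(** * Cutting the clusters into parts and embedding the cycle *)

Section Embedding.

Variables (V I : finType) (e : rel V) (R : rel I) (X : I -> {set V}).
Hypotheses (esym : symmetric e) (eirr : irreflexive e) (Rsym : symmetric R).
Hypothesis Xdisj : forall i j x, x \in X i -> x \in X j -> i = j.

(** A cluster is the first member of at most one pair and the second member of at most one, so it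
    offers [M] vertices to each, and a pair yields a path of about [2 * M] vertices. The remaining
    [(4 * l + 18) * tau] vertices, up to rounding, are two reserved parts of [3 * tau] and a tree
    part of [(4 * l + 12) * tau]. *)
Lemma blow_up_cycle (m D tau l r t : nat) (c : 'I_t -> I) :
  (forall i, #|X i| = m) ->
  (forall i j, R i j -> joined e tau (X i) (X j)) ->
  (forall a, R (c a) (c (ordS a))) -> (forall i, #|[set a | c a == i]| <= D) ->
  1 < l -> l ^ r.-1 <= tau <= l ^ r -> 0 < #|I| <= tau -> 0 < D ->
  D + (4 * l + 60) * tau <= m -> 2 * r + 4 + 2 * #|I| <= t ->
  exists C, [/\ size C = t, uniq C & cycle e C].
Proof.
move=> cX JX cR cD l2 lr /andP[I0 Itau] D0 hm ht.
have tau0 : 0 < tau by apply: leq_trans Itau.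
pose M := (m - (4 * l + 18) * tau)./2.
pose N := 2 * (M - 2 * tau - 1).
pose code j := if j < M then 0 else if j < 2 * M then 1 else
  if j < 2 * M + 3 * tau then 2 else if j < 2 * M + 6 * tau then 3 else 4.
pose tag x := if [pick i | x \in X i] is Some i then
  Some (i, code (index x (enum (X i)))) else None.
have tagE i x : x \in X i -> tag x = Some (i, code (index x (enum (X i)))).
  move=> xi; rewrite /tag; case: pickP => [j xj|/(_ i)]; last by rewrite xi.
  by rewrite (Xdisj xj xi).
have hM : 2 * M + (4 * l + 18) * tau <= m <= 2 * M + (4 * l + 18) * tau + 1.
  by rewrite /M; move: hm; clear; lia.
have partX i k : part tag i k \subset X i.
  apply/subsetP=> x; rewrite inE /tag; case: pickP => // j xj /eqP[<- _].
  exact: xj.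
have partR i k lo hi : (forall j, lo <= j < hi -> code j = k) -> hi <= m ->
    hi - lo <= #|part tag i k|.
  move=> hcode him; apply: leq_trans (card_index_range lo (_ : hi <= #|X i|)) _.
    by rewrite cX.
  apply/subset_leq_card/subsetP=> x; rewrite !inE => /andP[xi hx].
  by rewrite (tagE i) // hcode.
have Etau : (4 * l + 60) * tau = (4 * l + 18) * tau + 42 * tau by rewrite -mulnDl -addnA.
rewrite Etau in hm.
have hM2 : D + 42 * tau <= 2 * M + 1 by move: hM hm; clear; lia.
have t0 : 0 < t by move: ht; clear; lia.
have [phases [pD pI u1 u2 phP]] := walk_matching t0 D0 cD.
have p0 : 0 < size phases by rewrite lt0n; apply: contraTneq pD => ->; rewrite -ltnNge.
have [ph0 ph0P] : exists ph0, ph0 \in phases.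
  by case: (phases) p0 => // ph s _; exists ph; rewrite inE eqxx.
have [x0 _] : exists x0, x0 \in X ph0.1.
  by apply/set0Pn; rewrite -card_gt0 cX; move: hm D0; clear; lia.
have phR : {in phases, forall ph, R ph.1 ph.2} by move=> ph /phP[a ->]; apply: cR.
have phC : {in phases &, forall ph ph', forall b,
    exists b', connect (double_cover R) (ph.2, b) (ph'.1, b')}.
  by move=> ph ph' /phP[a ->] /phP[a' ->] b; apply: walk_connect_any.
have Jp i j k k' : R i j -> joined e tau (part tag i k) (part tag j k').
  by move=> Rij; apply: joinedS (JX i j Rij).
have cmain i k : k < 2 -> M <= #|part tag i k|.
  case: k => [|[|//]] _.
    rewrite -{1}[M]subn0; apply: partR; last by move: hM; clear; lia.
    by move=> j /andP[_ h]; rewrite /code h.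
  have -> : M = 2 * M - M by clear; lia.
  apply: partR; last by move: hM; clear; lia.
  by move=> j /andP[h1 h2]; rewrite /code ltnNge h1 h2.
have croute i (b : bool) : 2 * tau + size phases <= #|part tag i (2 + b)|.
  apply: (@leq_trans (3 * tau)); first by move: pI Itau; clear; lia.
  have E3 : 3 * tau <= m by move: hm; clear; lia.
  have E6 : 2 * M + 6 * tau <= m by move: hM; clear; lia.
  case: b.
    have -> : 3 * tau = (2 * M + 6 * tau) - (2 * M + 3 * tau) by clear; lia.
    apply: partR => // j /andP[h1 h2]; rewrite /code h2 ltnNge.
    have -> : M <= j by move: h1; clear; lia.
    rewrite ltnNge; have -> : 2 * M <= j by move: h1; clear; lia.
    by rewrite ltnNge h1.
  have -> : 3 * tau = (2 * M + 3 * tau) - 2 * M by clear; lia.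
  apply: partR; last by move: E6; clear; lia.
  move=> j /andP[h1 h2]; rewrite /code h2 ltnNge.
  have -> : M <= j by move: h1; clear; lia.
  by rewrite ltnNge h1.
have ctree i : 2 * (2 * l + 4) * tau + 4 * tau <= #|part tag i 4|.
  apply: (@leq_trans (m - (2 * M + 6 * tau))).
    have -> : 2 * (2 * l + 4) * tau + 4 * tau = (4 * l + 12) * tau.
      by clear; rewrite -mulnDl; congr (_ * _); lia.
    have : (4 * l + 18) * tau = (4 * l + 12) * tau + 6 * tau by rewrite -mulnDl -addnA.
    by move: hM; clear; lia.
  apply: partR => // j /andP[h1 h2]; rewrite /code.
  rewrite ltnNge; have -> : M <= j by move: h1; clear; lia.
  rewrite ltnNge; have -> : 2 * M <= j by move: h1; clear; lia.
  rewrite ltnNge; have -> : 2 * M + 3 * tau <= j by move: h1; clear; lia.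
  by rewrite ltnNge h1.
have closed0 : connect (double_cover R) ((nth ph0 phases 0).1, false) ((nth ph0 phases 0).1, odd t).
  by have [a ->] := phP _ (mem_nth ph0 p0); apply: walk_connect_closed.
(* Each pair contributes at least [D + 6 * tau] vertices to the chain, and [size phases * D] already
   reaches [t]. *)
have hcap : t + 4 * tau + 2 <= size phases * (N - 4 * tau).
  apply: (@leq_trans (size phases * (D + 6 * tau))).
    rewrite mulnDr; have : 6 * tau <= size phases * (6 * tau) by rewrite leq_pmull.
    by move: pD tau0; clear; lia.
  by rewrite leq_mul2l /N; apply/orP; right; move: hM2 tau0; clear; lia.
apply: (@phases_cycle V I e R tau M N tag phases x0 ph0 esym Rsym Jp phR u1 u2 phC
  cmain croute _ _ _ _ l r t eirr l2 lr ctree p0 ht hcap _ closed0).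
- by rewrite tau0; move: hM2; clear; lia.
- by rewrite /N; move: hM2 tau0; clear; lia.
- by rewrite /N; move: hM2 tau0; clear; lia.
- by rewrite /N oddM.
- by rewrite /N; move: hM2 tau0 Itau; clear; lia.
Qed.

End Embedding.

(** * A regularity lemma for holes *)

Section Chunks.

Variables (V : finType) (m : nat).
Hypothesis m0 : 0 < m.
Implicit Types (A B H : {set V}) (P Q : {set {set V}}).

Lemma card_cover_uniform P k :
  trivIset P -> {in P, forall B, #|B| = k} -> #|cover P| = #|P| * k.
Proof.
move=> /eqP <- cP; rewrite -sum_nat_const.
by apply: eq_bigr.
Qed.

Lemma coverU P Q : cover (P :|: Q) = cover P :|: cover Q.
Proof.
apply/setP=> x; rewrite in_setU; apply/bigcupP/orP.
  by case=> B; rewrite in_setU => /orP[] BP xB; [left|right]; apply/bigcupP; exists B.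
by case=> /bigcupP[B BP xB]; exists B => //; rewrite in_setU BP ?orbT.
Qed.

Lemma cover_subset P A : {in P, forall B, B \subset A} -> cover P \subset A.
Proof. by move=> PA; apply/bigcupsP=> B /PA. Qed.

Lemma equal_chunks A : exists Q, [/\ trivIset Q,
  {in Q, forall B, B \subset A /\ #|B| = m} & #|A :\: cover Q| < m].
Proof.
move: {2}#|A| (leqnn #|A|) => n; elim: n A => [|n IH] A cA.
  exists set0; split; first by apply/trivIsetP=> B C; rewrite inE.
    by move=> B; rewrite inE.
  by apply: leq_ltn_trans m0; apply: leq_trans cA; apply/subset_leq_card/subsetDl.
have [h|h] := ltnP #|A| m.
  exists set0; split; first by apply/trivIsetP=> B C; rewrite inE.
    by move=> B; rewrite inE.
  by apply: leq_ltn_trans h; apply/subset_leq_card/subsetDl.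
have [C CA cC] := exists_subset_card h.
have [|Q [tQ QA hQ]] := IH (A :\: C).
  by rewrite cardsDS // cC; move: cA m0; clear; lia.
have dCQ : [disjoint C & cover Q].
  rewrite disjoint_sym disjoint_subset; apply: subset_trans (_ : cover Q \subset A :\: C) _.
    by apply: cover_subset => B /QA[].
  by apply/subsetP=> x; rewrite !inE => /andP[].
have cov1 : cover [set C] = C by rewrite /cover big_set1.
exists ([set C] :|: Q); split.
- apply: trivIsetU => //; last by rewrite cov1.
  by apply/trivIsetP=> B B'; rewrite !inE => /eqP-> /eqP->; rewrite eqxx.
- move=> B; rewrite !inE => /orP[/eqP->//|/QA[BA ->]]; split=> //.
  exact: subset_trans BA (subsetDl _ _).
- by rewrite coverU cov1 -setDDl.
Qed.

(** Splitting along the members of [hs] in turn produces at most [2 ^ size hs] atoms, and each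
    wastes fewer than [m] vertices. *)
Lemma adapted_chunks (hs : seq {set V}) A : exists Q, [/\ trivIset Q,
  {in Q, forall B, B \subset A /\ #|B| = m},
  {in Q & hs, forall B H, B \subset H \/ [disjoint B & H]} &
  #|A :\: cover Q| <= 2 ^ size hs * m].
Proof.
elim: hs A => [|H hs IH] A.
  have [Q [tQ QA hQ]] := equal_chunks A; exists Q; split=> //.
  by rewrite expn0 mul1n ltnW.
have [Q1 [tQ1 QA1 hQ1 c1]] := IH (A :&: H).
have [Q2 [tQ2 QA2 hQ2 c2]] := IH (A :\: H).
have s1 : cover Q1 \subset A :&: H by apply: cover_subset => B /QA1[].
have s2 : cover Q2 \subset A :\: H by apply: cover_subset => B /QA2[].
exists (Q1 :|: Q2); split.
- apply: trivIsetU => //; rewrite -setI_eq0 -subset0.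
  apply: subset_trans (setISS s1 s2) _.
  by apply/subsetP=> x; rewrite !inE; case: (x \in H); rewrite ?andbF.
- move=> B; rewrite in_setU => /orP[/QA1|/QA2] [BA ->]; split=> //.
    exact: subset_trans BA (subsetIl _ _).
  exact: subset_trans BA (subsetDl _ _).
- move=> B H'; rewrite in_setU in_cons => /orP[] BQ /orP[/eqP->|H'h].
  + by left; have [BA _] := QA1 _ BQ; apply: subset_trans BA (subsetIr _ _).
  + exact: hQ1.
  + right; have [BA _] := QA2 _ BQ; rewrite disjoint_subset; apply: subset_trans BA _.
    by apply/subsetP=> x; rewrite !inE => /andP[].
  + exact: hQ2.
- apply: (@leq_trans (#|(A :&: H) :\: cover Q1| + #|(A :\: H) :\: cover Q2|)); last first.
    by move: c1 c2; rewrite /= expnS; clear; nia.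
  apply: leq_trans (leq_card_setU _ _); apply/subset_leq_card/subsetP=> x.
  rewrite coverU !inE negb_or => /andP[/andP[-> ->] ->].
  by case: (x \in H).
Qed.

Lemma adapted_refinement (hs : seq {set V}) P : trivIset P -> exists P', [/\ trivIset P',
  {in P', forall B, #|B| = m},
  {in P', forall B, exists2 A, A \in P & B \subset A},
  {in P' & hs, forall B H, B \subset H \/ [disjoint B & H]} &
  #|cover P :\: cover P'| <= #|P| * (2 ^ size hs * m)].
Proof.
move=> tP; have [Q HQ] := fin_all_exists (adapted_chunks hs).
exists (\bigcup_(A in P) Q A); split.
- apply/trivIsetP=> B C /bigcupP[A AP BQ] /bigcupP[A' A'P CQ] BC.
  have [tQ QA _ _] := HQ A; have [_ QA' _ _] := HQ A'.
  have [E|AA'] := eqVneq A A'; first by move/trivIsetP: tQ; apply; rewrite // E.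
  have [BA _] := QA _ BQ; have [CA _] := QA' _ CQ.
  by apply: disjointWl BA _; apply: disjointWr CA _; move/trivIsetP: tP; apply.
- by move=> B /bigcupP[A AP BQ]; have [_ QA _ _] := HQ A; case: (QA _ BQ).
- by move=> B /bigcupP[A AP BQ]; have [_ QA _ _] := HQ A; exists A => //; case: (QA _ BQ).
- by move=> B H /bigcupP[A AP BQ]; have [_ _ hQ _] := HQ A; apply: hQ.
- have sub : cover P :\: cover (\bigcup_(A in P) Q A) \subset
      \bigcup_(A in P) (A :\: cover (Q A)).
    apply/subsetP=> x; rewrite inE => /andP[xn /bigcupP[A AP xA]].
    apply/bigcupP; exists A => //; rewrite inE xA andbT; apply: contra xn.
    by case/bigcupP=> B BQ xB; apply/bigcupP; exists B => //; apply/bigcupP; exists A.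
  apply: leq_trans (subset_leq_card sub) _; rewrite -sum_nat_const.
  apply: (@leq_trans (\sum_(A in P) #|A :\: cover (Q A)|)).
    elim/big_rec2: _ => [|A n U _ IH]; first by rewrite cards0.
    by apply: leq_trans (leq_card_setU _ _) _; rewrite leq_add2l.
  by apply: leq_sum => A _; have [] := HQ A.
Qed.

End Chunks.

Section HoleIncrement.

Variables (V : finType) (e : rel V).
Implicit Types (A B H : {set V}) (P Q : {set {set V}}).

(** Pairs spanning no edge are not bad; they correspond to regular pairs of density zero. *)
Definition bad_pairs tau P : {set {set V} * {set V}} :=
  [set AB in setX P P | has_edge e AB.1 AB.2 && ~~ joined e tau AB.1 AB.2].

Definition empty_area P : {set V * V} :=
  [set xy in setX (cover P) (cover P) | ~~ has_edge e (pblock P xy.1) (pblock P xy.2)].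

Lemma has_edgeS (A B A' B' : {set V}) :
  A' \subset A -> B' \subset B -> has_edge e A' B' -> has_edge e A B.
Proof.
move=> sA sB /has_edgeP[x [y [xA yB xy]]]; apply/has_edgeP; exists x, y.
by rewrite (subsetP sA) ?(subsetP sB).
Qed.

(** A bad pair contains a hole, an edgeless rectangle with sides at least [tau]. Cutting all
    clusters along the holes turns each hole into empty pairs of new clusters; its area was not
    counted before, since a bad pair spans an edge. The last term pays for the vertices left over by
    the cutting. *)
Lemma hole_increment tau P m : trivIset P -> 0 < m ->
  exists P' : {set {set V}}, [/\ trivIset P', {in P', forall B, #|B| = m},
    #|cover P :\: cover P'| <= #|P| * (2 ^ (2 * #|P| ^ 2) * m), cover P' \subset cover P &
    #|empty_area P| + #|bad_pairs tau P| * tau ^ 2 <=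
      #|empty_area P'| + 2 * #|V| * #|cover P :\: cover P'|].
Proof.
move=> tP m0.
have hole (AB : {set V} * {set V}) : exists UW : {set V} * {set V},
    AB \in bad_pairs tau P -> [/\ UW.1 \subset AB.1, UW.2 \subset AB.2,
      tau <= #|UW.1|, tau <= #|UW.2| & ~~ has_edge e UW.1 UW.2].
  have [h|h] := boolP (AB \in bad_pairs tau P); last by exists AB.
  move: h; rewrite inE => /and3P[_ _ /forallPn[U /forallPn[W]]].
  by rewrite negb_imply => /andP[/and4P[UA WB tU tW] nh]; exists (U, W).
have [u hu] := fin_all_exists hole.
pose hs := [seq (u (A, B)).1 | A <- enum P, B <- enum P] ++
           [seq (u (A, B)).2 | A <- enum P, B <- enum P].
have shs : size hs = 2 * #|P| ^ 2.
  by rewrite size_cat !size_allpairs -!cardE mul2n addnn -mulnn.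
have [P' [tP' cP' refP hP covP]] := adapted_refinement m0 hs tP.
rewrite shs in covP.
have subc : cover P' \subset cover P.
  apply: cover_subset => B /refP[A AP BA]; apply: subset_trans BA _.
  exact: bigcup_sup.
exists P'; split=> //.
pose H := [set xy in setX (cover P) (cover P) |
  let AB := (pblock P xy.1, pblock P xy.2) in
  [&& AB \in bad_pairs tau P, xy.1 \in (u AB).1 & xy.2 \in (u AB).2]].
have cH : #|bad_pairs tau P| * tau ^ 2 <= #|H|.
  rewrite -sum_nat_const -[leqRHS]sum1_card.
  rewrite (partition_big (fun xy => (pblock P xy.1, pblock P xy.2)) (mem (bad_pairs tau P))) /=; last first.
    by move=> xy; rewrite inE => /andP[_ /and3P[]].
  apply: leq_sum => AB AB_bad; have [UA WB tU tW _] := hu AB AB_bad.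
  have [AP BP] : AB.1 \in P /\ AB.2 \in P.
    by move: AB_bad; rewrite 2!inE => /andP[/andP[]].
  apply: (@leq_trans #|setX (u AB).1 (u AB).2|); first by rewrite cardsX -mulnn leq_mul.
  rewrite sum1dep_card; apply/subset_leq_card/subsetP=> -[x y].
  rewrite in_setX => /= /andP[xU yW].
  have xA := subsetP UA x xU; have yB := subsetP WB y yW.
  rewrite !inE /= (def_pblock tP AP xA) (def_pblock tP BP yB) -surjective_pairing.
  rewrite eqxx andbT xU yW AB_bad !andbT -!mem_pblock.
  by rewrite (def_pblock tP AP xA) (def_pblock tP BP yB) xA.
have dis : empty_area P :&: H = set0.
  apply/setP=> xy; rewrite in_setI in_set0; apply/negP=> /andP[].
  rewrite !inE /= => /andP[_ /negP ne] /and4P[_ + _ _]; rewrite inE => /and3P[_ he _].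
  exact: ne.
have sub : empty_area P :|: H \subset empty_area P' :|:
    (setX (cover P :\: cover P') [set: V] :|: setX [set: V] (cover P :\: cover P')).
  apply/subsetP=> -[x y] xyU; have [xc yc] : x \in cover P /\ y \in cover P.
    by move: xyU; rewrite in_setU => /orP[]; rewrite !inE /= => /andP[/andP[]].
  rewrite !in_setU !in_setX !in_setD xc yc !in_setT !andbT andTb.
  have [xc'|] := boolP (x \in cover P'); last by rewrite orbT.
  have [yc'|] := boolP (y \in cover P'); last by rewrite !orbT.
  rewrite !orbF inE in_setX xc' yc' /=.
  have [A AP BA] := refP _ (pblock_mem xc'); have [A' AP' BA'] := refP _ (pblock_mem yc').
  have xB : x \in pblock P' x by rewrite mem_pblock.
  have yB : y \in pblock P' y by rewrite mem_pblock.
  have EA : pblock P x = A := def_pblock tP AP (subsetP BA x xB).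
  have EA' : pblock P y = A' := def_pblock tP AP' (subsetP BA' y yB).
  move: xyU; rewrite in_setU => /orP[].
    by rewrite inE /= EA EA' => /andP[_]; apply: contra; apply: has_edgeS.
  rewrite inE /= EA EA' => /andP[_ /and3P[bad xU yW]].
  have [_ _ _ _] := hu _ bad; apply: contra; apply: has_edgeS.
    have [||/disjointFr/(_ xB)] := hP _ (u (A, A')).1 (pblock_mem xc'); rewrite ?xU //.
    by rewrite mem_cat; apply/orP; left; apply/allpairsP; exists (A, A'); rewrite !mem_enum.
  have [||/disjointFr/(_ yB)] := hP _ (u (A, A')).2 (pblock_mem yc'); rewrite ?yW //.
  by rewrite mem_cat; apply/orP; right; apply/allpairsP; exists (A, A'); rewrite !mem_enum.
have h3 := subset_leq_card sub; rewrite cardsU dis cards0 subn0 in h3.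
apply: leq_trans (leq_add (leqnn _) cH) _; apply: leq_trans h3 _.
apply: leq_trans (leq_card_setU _ _) _; rewrite leq_add2l.
apply: leq_trans (leq_card_setU _ _) _.
by rewrite !cardsX cardsT mulnC addnn -mul2n mulnA.
Qed.

End HoleIncrement.

(* A sparse regularity lemma in which "regular" only means that large parts of
   two clusters span an edge. The potential is the area of the pairs of clusters
   spanning no edge at all: it grows by a constant proportion of [#|V| ^ 2] when
   all clusters are cut along the holes of the bad pairs. *)
Section HoleRegularity.

Variables (a g A : nat).
Hypotheses (a0 : 0 < a) (g0 : 0 < g) (A1 : 1 < A).

Definition hole_regular N (V : finType) (e : rel V) (P : {set {set V}}) m :=
  [/\ trivIset P, {in P, forall B : {set V}, #|B| = m}, #|V| <= N * m, A * m <= #|V| &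
    A * #|~: cover P| <= #|V| /\ g * #|bad_pairs e (m %/ a).+1 P| <= #|P| ^ 2].

(** Every round adds at least [#|V| ^ 2 / S] to the empty area, so [S + 1] rounds are impossible.
    [T] is the number of indices from 0 to [S + 1], among which the permitted waste [#|V| / A] is
    divided. *)
Let S := 8 * g * a ^ 2.
Let T := S.+2.

Let state r N (V : finType) (e : rel V) (P : {set {set V}}) m :=
  [/\ trivIset P, {in P, forall B : {set V}, #|B| = m}, #|V| <= N * m, A * m <= #|V| &
    T * A * #|~: cover P| <= r.+1 * #|V| /\ r * #|V| ^ 2 <= S * #|empty_area e P|].

(** In [D] the factor [N * 2 ^ (2 * N ^ 2)] bounds the number of atoms. The summand [2 * S] keeps
    the loss of area below half of the gain, and [T * A] keeps the new waste within the share of one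
    round. *)
Lemma hole_regularity_step r N (V : finType) (e : rel V) P m :
  let D := (2 * S + T * A) * N * 2 ^ (2 * N ^ 2) in
  0 < N -> r < T -> 2 * D <= #|V| -> state r N e P m ->
  g * #|bad_pairs e (m %/ a).+1 P| <= #|P| ^ 2 \/
  exists P' m', state r.+1 (2 * D) e P' m'.
Proof.
move=> D N0 rT hn [tP cP Nm Am [covP areaP]].
set n := #|V| in hn Nm Am covP areaP.
set b := #|bad_pairs e (m %/ a).+1 P|.
have [h|h] := leqP (g * b) (#|P| ^ 2); [by left | right].
have S0 : 0 < S by rewrite !muln_gt0 g0 a0.
have D0 : 0 < D.
  by rewrite !muln_gt0 expn_gt0 N0 addn_gt0 muln_gt0 S0.
pose m' := n %/ D.
have m'0 : 0 < m' by rewrite divn_gt0 //; move: hn; clear; lia.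
have [P' [tP' cP' leftP subP areaP']] := hole_increment e (m %/ a).+1 tP m'0.
set lo := #|cover P :\: cover P'| in leftP areaP'.
have cardc := cardsC (cover P).
have covPm := card_cover_uniform tP cP.
have n0 : 0 < n by move: D0 hn; clear; lia.
have PN : #|P| <= N.
  have m0 : 0 < m by rewrite lt0n; apply: contraTneq n0 => Em; rewrite -leqNgt; move: Nm; rewrite Em muln0.
  rewrite -(leq_pmul2r m0) -covPm; apply: leq_trans Nm; exact: max_card.
have lo_le : (2 * S + T * A) * lo <= n.
  apply: leq_trans (leq_divM n D).
  have -> : n %/ D * D = (2 * S + T * A) * (N * 2 ^ (2 * N ^ 2) * m').
    by rewrite -/m' mulnC -!mulnA.
  rewrite leq_mul2l; apply/orP; right; apply: leq_trans leftP _.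
  rewrite mulnA leq_mul2r; apply/orP; right; apply: leq_mul => //.
  by rewrite leq_exp2l // leq_mul2l leq_sqr PN.
have Dm' : D * m' <= n by rewrite mulnC leq_divM.
have compl' : #|~: cover P'| = #|~: cover P| + lo.
  rewrite /lo cardsDS //; have := cardsC (cover P'); have := subset_leq_card subP.
  by move: cardc; clear; lia.
exists P', m'; split=> //.
- by have := ltn_ceil n D0; rewrite -/m'; move: m'0; clear; nia.
- apply: leq_trans Dm'; rewrite leq_mul2r; apply/orP; right.
  apply: (@leq_trans ((2 * S + T * A) * N)); last by rewrite leq_pmulr // expn_gt0.
  apply: leq_trans (leq_pmulr _ N0).
  by apply: leq_trans (leq_addl _ _); rewrite leq_pmull.
split.
- rewrite compl' mulnDr -/n mulSn addnC; apply: leq_add covP.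
  by apply: leq_trans lo_le; rewrite leq_mul2r leq_addl orbT.
have cov2 : n <= 2 * #|cover P|.
  have : A * #|~: cover P| <= n.
    rewrite -(leq_pmul2l (_ : 0 < T)) // mulnA; apply: leq_trans covP _.
    by rewrite leq_mul2r rT orbT.
  have : 2 * #|~: cover P| <= A * #|~: cover P| by rewrite leq_mul2r A1 orbT.
  by move: cardc; rewrite -/n; clear; lia.
(* The holes have total area at least [#|cover P| ^ 2 / (g * a ^ 2)] and the clusters cover at least
   half of [V], hence the factor 8 in [S]. *)
have gain : 2 * n ^ 2 <= S * (b * (m %/ a).+1 ^ 2).
  have m_le : m <= a * (m %/ a).+1 by rewrite mulnC ltnW // ltn_ceil.
  have -> : S * (b * (m %/ a).+1 ^ 2) = 8 * ((g * b) * (a * (m %/ a).+1) ^ 2).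
    by rewrite /S expnMn; clear; lia.
  apply: (@leq_trans (8 * (#|P| ^ 2 * m ^ 2))); last first.
    by rewrite leq_mul2l leq_mul ?orbT // ?leq_sqr // ltnW.
  by rewrite -expnMn -covPm; move: cov2; clear; nia.
have loss : 2 * S * (n * lo) <= n ^ 2.
  rewrite mulnCA -mulnn leq_mul2l; apply/orP; right.
  by apply: leq_trans lo_le; rewrite leq_mul2r leq_addr orbT.
have : S * (#|empty_area e P| + b * (m %/ a).+1 ^ 2) <= S * (#|empty_area e P'| + 2 * n * lo).
  by rewrite leq_mul2l areaP' orbT.
rewrite !mulnDr mulSn -/n (_ : S * (2 * n * lo) = 2 * S * (n * lo)); last by clear; lia.
by move: areaP gain loss; clear; lia.
Qed.

Theorem hole_regularity : exists N, 0 < N /\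
  forall (V : finType) (e : rel V), N <= #|V| ->
  exists (P : {set {set V}}) m, hole_regular N e P m.
Proof.
have main r : r < T -> exists N, 0 < N /\
    forall (V : finType) (e : rel V), N <= #|V| ->
    exists (P : {set {set V}}) m, hole_regular N e P m \/ state r N e P m.
  elim: r => [|r IH] rT.
    have TA : 0 < T * A by rewrite muln_gt0 /=; move: A1; clear; lia.
    exists (2 * (T * A)); split=> [|V e hV]; first by rewrite muln_gt0.
    pose m := #|V| %/ (T * A).
    have m0 : 0 < m by rewrite divn_gt0 //; move: hV; clear; lia.
    have [Q [tQ QA hQ]] := equal_chunks m0 [set: V].
    have mle : T * A * m <= #|V| by rewrite mulnC leq_divM.
    exists Q, m; right; split=> //.
    - by move=> B /QA[].
    - have := ltn_ceil #|V| TA; rewrite -/m mulSn mulnC -mulnA; clear -m0; nia.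
    - by apply: leq_trans mle; rewrite leq_mul2r leq_pmull ?orbT.
    split; last by rewrite mul0n.
    rewrite -setTD mul1n; apply: leq_trans mle; rewrite leq_mul2l.
    by apply/orP; right; apply: ltnW.
  have [N [N0 HN]] := IH (ltnW rT).
  pose D := (2 * S + T * A) * N * 2 ^ (2 * N ^ 2).
  have ND : N <= 2 * D.
    have TA : 0 < T * A by rewrite muln_gt0 /=; move: A1; clear; lia.
    apply: leq_trans (leq_pmull _ (isT : 0 < 2)); rewrite /D -mulnA.
    apply: leq_trans (leq_pmull _ (_ : 0 < 2 * S + T * A)); first by rewrite leq_pmulr ?expn_gt0.
    by rewrite addn_gt0 TA orbT.
  exists (2 * D); split=> [|V e hV]; first by apply: leq_trans ND.
  have [P [m [[tP cP Nm Am cA]|st]]] := HN V e (leq_trans ND hV).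
    exists P, m; left; split=> //.
    by apply: leq_trans Nm _; rewrite leq_mul2r ND orbT.
  have [hg|[P' [m' st']]] := hole_regularity_step N0 (ltnW rT) hV st; last by exists P', m'; right.
  exists P, m; left; case: st => tP cP Nm Am [covP _]; split=> //.
    by apply: leq_trans Nm _; rewrite leq_mul2r ND orbT.
  split=> //; rewrite -(leq_pmul2l (_ : 0 < T)) // mulnA.
  by apply: leq_trans covP _; rewrite leq_mul2r ltnW ?orbT.
have [N [N0 HN]] := main S.+1 (leqnn _).
exists N; split=> // V e hV.
have [P [m [reg|[tP cP Nm Am [_ area]]]]] := HN V e hV; first by exists P, m.
have : #|empty_area e P| <= #|V| ^ 2.
  by apply: leq_trans (max_card _) _; rewrite card_prod mulnn.
have : 0 < #|V| by apply: leq_trans hV.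
by move: area; clear; nia.
Qed.

End HoleRegularity.

(** * Graphs and blow-ups *)

Section Graphs.

Variable V : finType.
Implicit Types (G F : sgraph V).

Lemma adj_sym G : symmetric (adj G).
Proof. by move=> x y; rewrite /adj setUC. Qed.

Lemma adj_irr G : irreflexive (adj G).
Proof.
move=> x; apply/negP=> xG; have /forall_inP/(_ _ xG) := edges_card2 G.
by rewrite cards2 eqxx.
Qed.

Lemma card_adj G : #|[set xy : V * V | adj G xy.1 xy.2]| = 2 * num_edges G.
Proof.
rewrite -sum1_card (partition_big (fun xy => [set xy.1; xy.2]) (mem (edges G))) /=; last first.
  by move=> xy; rewrite inE.
rewrite /num_edges mulnC -sum_nat_const; apply: eq_bigr => E EG.
have /cards2P[x [y [xy EE]]] := forall_inP (edges_card2 G) _ EG.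
rewrite sum1dep_card (_ : [set _ | _] = [set (x, y); (y, x)]).
  by rewrite cards2 xpair_eqE negb_and xy.
apply/setP=> -[u v]; rewrite !inE /= !xpair_eqE /adj.
apply/andP/orP.
  case=> _ /eqP E'; have : u \in E by rewrite -E' !inE eqxx.
  have : v \in E by rewrite -E' !inE eqxx orbT.
  have : x \in [set u; v] by rewrite E' EE !inE eqxx.
  have : y \in [set u; v] by rewrite E' EE !inE eqxx orbT.
  rewrite EE !inE => /orP[]/eqP Ey /orP[]/eqP Ex _ _; subst.
  - by rewrite eqxx in xy.
  - by right; rewrite !eqxx.
  - by left; rewrite !eqxx.
  - by rewrite eqxx in xy.
case=> /andP[/eqP-> /eqP->]; rewrite -?EE ?EG //.
by rewrite setUC -EE EG.
Qed.

Definition rel_graph (r : rel V) : sgraph V :=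
  SGraph (pairs_card2 [set [set xy.1; xy.2] | xy in [set xy : V * V | r xy.1 xy.2]]).

Lemma rel_graph_adj r : symmetric r -> irreflexive r -> adj (rel_graph r) =2 r.
Proof.
move=> rsym rirr x y; rewrite /adj /= inE; apply/andP/idP.
  case=> /imsetP[[u v]]; rewrite inE /= => uv E; rewrite cards2 => /eqP[/eqP].
  rewrite eqb1 => xy.
  have : x \in [set u; v] by rewrite -E !inE eqxx.
  have : y \in [set u; v] by rewrite -E !inE eqxx orbT.
  rewrite !inE => /orP[]/eqP Ey /orP[]/eqP Ex; subst; rewrite ?eqxx // in xy *.
  by rewrite rsym.
move=> xy; split; first by apply/imsetP; exists (x, y); rewrite ?inE.
by rewrite cards2 (_ : x != y) //; apply: contraTneq xy => ->; rewrite rirr.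
Qed.

End Graphs.

Lemma cycle_nth (V : eqType) (e : rel V) (x0 : V) C i :
  cycle e C -> i < size C -> e (nth x0 C i) (nth x0 C (i.+1 %% size C)).
Proof.
case: C => // x p /= /(pathP x0); rewrite size_rcons => H hi.
have := H i hi; rewrite -rcons_cons nth_rcons /= hi.
move: hi; rewrite ltnS leq_eqVlt => /orP[/eqP->|hi].
  by rewrite modnn /= nth_rcons ltnn eqxx.
by rewrite modn_small // nth_rcons hi.
Qed.

Lemma ordS_neq t (a : 'I_t) : 1 < t -> ordS a != a.
Proof.
move=> t1; apply/negP=> /eqP/(congr1 val) /=; have := ltn_ord a.
rewrite leq_eqVlt => /orP[/eqP E|h]; last by rewrite modn_small //; clear; lia.
by rewrite E modnn; move: E t1; clear; lia.
Qed.

Lemma adj_cycle_ordS t (a : 'I_t) : 1 < t -> adj (cycle_graph t) a (ordS a).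
Proof.
move=> t1; rewrite /adj /= inE; apply/andP; split; first by apply/imsetP; exists a.
by rewrite cards2; have := ordS_neq a t1; rewrite eq_sym => ->.
Qed.

Lemma cycle_has_copy (V : finType) (F : sgraph V) C :
  uniq C -> cycle (adj F) C -> has_copy F (cycle_graph (size C)).
Proof.
move=> uC cC; have [C0|] := eqVneq (size C) 0.
  apply/existsP; exists (finfun (fun i : 'I_(size C) => tnth (in_tuple C) i)).
  apply/andP; split; first by apply/injectiveP=> -[i hi]; exfalso; rewrite C0 in hi.
  by apply/forallP=> -[i hi]; exfalso; rewrite C0 in hi.
rewrite -lt0n => C0; have [x0 _] : exists x0, x0 \in C.
  by case: (C) C0 => // x p _; exists x; rewrite inE eqxx.
apply/existsP; exists [ffun i : 'I_(size C) => nth x0 C i]; apply/andP; split.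
  by apply/injectiveP=> i j; rewrite !ffunE => /eqP; rewrite nth_uniq // => /eqP/val_inj.
apply/forallP=> i; apply/forallP=> j; apply/implyP; rewrite !ffunE.
rewrite /adj /= inE => /andP[/imsetP[k _ E] c2].
have step : adj F (nth x0 C k) (nth x0 C (ordS k)) by apply: cycle_nth.
have : i \in [set k; ordS k] by rewrite -E !inE eqxx.
have : j \in [set k; ordS k] by rewrite -E !inE eqxx orbT.
rewrite !inE => /orP[]/eqP Ej /orP[]/eqP Ei; subst => //.
- by rewrite setUid cards1 in c2.
- by have := adj_sym F (nth x0 C (ordS k)) (nth x0 C k); rewrite /adj => ->.
- by rewrite setUid cards1 in c2.
Qed.

Section BlowUp.

Variables (V I : finType) (R : rel I) (X : I -> {set V}) (D t : nat).
Hypotheses (Rsym : symmetric R) (Rirr : irreflexive R).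
Hypothesis Xdisj : forall i j x, x \in X i -> x \in X j -> i = j.
Hypothesis cX : forall i, #|X i| = D.

(** The blow-up of [R] along the sets [X i] has more edges than the extremal number and so contains
    the cycle. Reading off clusters gives the closed walk, and injectivity of the copy bounds the
    visits to [i] by [#|X i|]. *)
Lemma dense_blow_up_walk : 1 < t ->
  2 * ex_n #|V| (cycle_graph t) < #|[set ij : I * I | R ij.1 ij.2]| * D ^ 2 ->
  exists c : 'I_t -> I,
    (forall a, R (c a) (c (ordS a))) /\ forall i, #|[set a | c a == i]| <= D.
Proof.
move=> t1 dense.
pose bl x y := [exists ij : I * I, [&& x \in X ij.1, y \in X ij.2 & R ij.1 ij.2]].
have blP x y : reflect (exists i j, [/\ x \in X i, y \in X j & R i j]) (bl x y).
  apply: (iffP existsP) => [[[i j] /and3P[xi yj ij]]|[i [j [xi yj ij]]]].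
    by exists i, j.
  by exists (i, j); rewrite xi yj ij.
(* The blow-up is moved to ['I_#|V|], the vertex set of the complete graph in [ex_n]. *)
pose g (u : 'I_#|V|) : V := enum_val u.
have ginj : injective g by apply: enum_val_inj.
pose bg := rel_graph (fun u v => bl (g u) (g v)).
have bgE : adj bg =2 fun u v => bl (g u) (g v).
  apply: rel_graph_adj => [u v|u].
    by apply/blP/blP=> -[i [j [ui vj ij]]]; exists j, i; rewrite Rsym.
  by apply/blP=> -[i [j [ui vj]]]; rewrite (Xdisj ui vj) Rirr.
have big : #|[set ij : I * I | R ij.1 ij.2]| * D ^ 2 <= 2 * num_edges bg.
  pose cl u := [pick i | g u \in X i].
  have clE u i : g u \in X i -> cl u = Some i.
    rewrite /cl; case: pickP => [j uj ui|/(_ i) -> //].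
    by rewrite (Xdisj uj ui).
  pose Q := [set (Some ij.1, Some ij.2) | ij in [set ij : I * I | R ij.1 ij.2]].
  have cardpre i : #|g @^-1: X i| = D.
    by rewrite on_card_preimset // -?(cX i) //; apply: onW_bij; apply: enum_val_bij.
  rewrite -card_adj -[leqRHS]sum1_card (partition_big (fun uv => (cl uv.1, cl uv.2)) (mem Q)) /=.
    have -> : #|[set ij : I * I | R ij.1 ij.2]| = #|Q|.
      by rewrite card_imset // => -[i j] [i' j'] [-> ->].
    rewrite -sum_nat_const; apply: leq_sum => o /imsetP[[i j]]; rewrite inE /= => ij ->.
    rewrite sum1dep_card -mulnn -{1}(cardpre i) -(cardpre j) -cardsX.
    apply/subset_leq_card/subsetP=> -[u v]; rewrite !inE /= => /andP[ui vj].
    rewrite (clE u i) // (clE v j) // eqxx andbT bgE.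
    by apply/blP; exists i, j.
  move=> [u v]; rewrite inE bgE /= => /blP[i [j [ui vj ij]]].
  by rewrite (clE u i) // (clE v j) //; apply/imsetP; exists (i, j); rewrite ?inE.
have : has_copy bg (cycle_graph t).
  apply: contraTT dense => nc; rewrite -leqNgt; apply: leq_trans big _.
  rewrite leq_mul2l; apply/orP; right.
  apply: (@leq_bigmax_cond _ (fun F : sgraph 'I_#|V| => _) (fun F => num_edges F) bg).
  rewrite nc andbT; apply/subsetP=> E EE; rewrite !inE /=.
  exact: (forall_inP (edges_card2 bg) _ EE).
case/existsP=> f /andP[/injectiveP finj /forallP fadj].
have step a : bl (g (f a)) (g (f (ordS a))).
  by rewrite -bgE; have /forallP/(_ (ordS a)) := fadj a; rewrite adj_cycle_ordS.
have /fin_all_exists[c cP] : forall a, exists i, g (f a) \in X i.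
  by move=> a; have /blP[i [j [h _ _]]] := step a; exists i.
exists c; split=> [a|i].
  have /blP[i [j [hi hj ij]]] := step a.
  by rewrite -(Xdisj hi (cP a)) -(Xdisj hj (cP (ordS a))).
rewrite -(cX i) -(card_imset _ (inj_comp ginj finj)).
by apply/subset_leq_card/subsetP=> x /imsetP[a]; rewrite inE => /eqP <- ->; apply: cP.
Qed.

End BlowUp.

(** * Edge counts *)

Section PairCounts.

Variables (V : finType) (e : rel V).
Implicit Types (S U W X Y : {set V}) (P : {set {set V}}).

(** Pairs are ordered: for disjoint sets this is [edges_between], while edges inside a common part
    count twice. *)
Definition pair_count U W := #|[set xy in setX U W | e xy.1 xy.2]|.

Lemma pair_count_sum U W : pair_count U W = \sum_(x in U) \sum_(y in W) e x y.
Proof.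
rewrite /pair_count -sum1_card pair_big_dep /= big_mkcond [RHS]big_mkcond.
by apply: eq_bigr => -[x y] _; rewrite !inE /=; do 2!case: (_ \in _) => //=; case: e.
Qed.

Lemma pair_countS U W U' W' : U \subset U' -> W \subset W' ->
  pair_count U W <= pair_count U' W'.
Proof.
move=> UU WW; apply/subset_leq_card/subsetP=> -[x y]; rewrite !inE /=.
by move=> /andP[/andP[/(subsetP UU)-> /(subsetP WW)->] ->].
Qed.

Hypothesis esym : symmetric e.

Lemma pair_countC U W : pair_count U W = pair_count W U.
Proof.
rewrite !pair_count_sum exchange_big; apply: eq_bigr => x _.
by apply: eq_bigr => y _; rewrite esym.
Qed.

Lemma pair_countDl x U W : x \in U ->
  pair_count U W = pair_count [set x] W + pair_count (U :\ x) W.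
Proof. by move=> xU; rewrite !pair_count_sum big_set1 (big_setD1 x). Qed.

Lemma pair_countDr x U W : x \in W ->
  pair_count U W = pair_count U [set x] + pair_count U (W :\ x).
Proof. by move=> xW; rewrite pair_countC (pair_countDl _ xW) !(pair_countC U). Qed.

Lemma pair_countU U U' W : [disjoint U & U'] ->
  pair_count (U :|: U') W = pair_count U W + pair_count U' W.
Proof.
move=> dis; rewrite !pair_count_sum (big_setID U) /=; congr (_ + _).
  by apply: eq_bigl => x; rewrite !inE; case: (x \in U); rewrite ?andbF.
apply: eq_bigl => x; rewrite !inE; case xU: (x \in U) => //=.
by rewrite (disjointFr dis xU).
Qed.

(* Greedy max-cut: each new vertex joins the side where it has fewer
   neighbours, so at least half of the edges inside [S] cross the cut. *)
Lemma max_cut S : irreflexive e ->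
  exists2 S1 : {set V}, S1 \subset S & pair_count S S <= 4 * pair_count S1 (S :\: S1).
Proof.
move=> eirr; move: {2}#|S| (leqnn #|S|) => n; elim: n S => [|n IH] S cS.
  exists set0; rewrite ?sub0set // (_ : pair_count S S = 0) //.
  move: cS; rewrite leqn0 cards_eq0 => /eqP->.
  by rewrite pair_count_sum big_set0.
have [->|/set0Pn[x xS]] := eqVneq S set0.
  by exists set0; rewrite ?sub0set // [X in X <= _]pair_count_sum big_set0.
have [|S1 S1S hS1] := IH (S :\ x); first by have := cardsD1 x S; rewrite xS; move: cS; clear; lia.
set S' := S :\ x in S1S hS1; set S2 := S' :\: S1 in hS1.
have xS1 : x \notin S1 by apply/negP=> /(subsetP S1S); rewrite !inE eqxx.
have xx : pair_count [set x] [set x] = 0.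
  by rewrite pair_count_sum !big_set1 eirr.
have S'E : S' = S1 :|: S2.
  by apply/setP=> y; rewrite !inE; case yS1: (y \in S1) => //=; move/(subsetP S1S): yS1; rewrite !inE.
have dis : [disjoint S1 & S2] by rewrite disjoint_sym disjoints_subset; apply/subsetP=> y; rewrite !inE => /andP[].
have hx : pair_count [set x] S' = pair_count [set x] S1 + pair_count [set x] S2.
  by rewrite pair_countC S'E pair_countU // !(pair_countC _ [set x]).
have tot : pair_count S S = pair_count S' S' + 2 * (pair_count [set x] S1 + pair_count [set x] S2).
  rewrite (pair_countDl _ xS) !(pair_countDr _ xS) -/S' xx add0n (pair_countC S' [set x]) hx.
  by clear; lia.
have [h|h] := leqP (pair_count [set x] S1) (pair_count [set x] S2).
  exists (x |: S1).
    by rewrite subUset sub1set xS; apply: subset_trans S1S (subD1set _ _).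
  have -> : S :\: (x |: S1) = S2 by rewrite /S2 /S' setDDl.
  rewrite pair_countU ?disjoints_subset ?sub1set ?inE //.
  by move: h hS1; rewrite tot; clear; lia.
exists S1; first by apply: subset_trans S1S (subD1set _ _).
have -> : S :\: S1 = x |: S2.
  by apply/setP=> y; rewrite !inE; case: eqP => [->|]; rewrite ?xS ?xS1.
rewrite pair_countC pair_countU ?disjoints_subset ?sub1set ?inE ?eqxx ?andbF //.
by move: h hS1; rewrite tot (pair_countC S2); clear; lia.
Qed.

End PairCounts.

Section EdgeDistribution.

Variables (V : finType) (e : rel V).
Hypothesis esym : symmetric e.

Definition joined_pairs tau (P : {set {set V}}) : {set {set V} * {set V}} :=
  [set AB in setX P P | (AB.1 != AB.2) && joined e tau AB.1 AB.2].

Definition linked_pairs (P : {set {set V}}) : {set {set V} * {set V}} :=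
  [set AB in setX P P | (AB.1 != AB.2) && has_edge e AB.1 AB.2].

Lemma card_linked_pairs tau P :
  #|linked_pairs P| <= #|joined_pairs tau P| + #|bad_pairs e tau P|.
Proof.
apply: leq_trans (leq_card_setU _ _); apply/subset_leq_card/subsetP=> AB.
by rewrite !inE => /and3P[-> -> ->]; case: joined.
Qed.

Lemma card_bigcup_leq (I : finType) (Q : {set I}) (F : I -> {set V * V}) :
  #|\bigcup_(i in Q) F i| <= \sum_(i in Q) #|F i|.
Proof.
elim/big_rec2: _ => [|i n U _ IH]; first by rewrite cards0.
by apply: leq_trans (leq_card_setU _ _) _; rewrite leq_add2l.
Qed.

(** An edge of [e] leaves the cover, lies inside a cluster or joins two linked clusters. Linked
    pairs are determined by [e], but edges are counted in the larger [f], to which upper-uniformity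
    will apply. *)
Lemma edge_distribution (f : rel V) P : symmetric f -> subrel e f ->
  #|[set xy : V * V | e xy.1 xy.2]| <= 2 * pair_count f (~: cover P) [set: V] +
    \sum_(A in P) pair_count f A A + \sum_(AB in linked_pairs P) pair_count f AB.1 AB.2.
Proof.
move=> fsym ef; pose E U W : {set V * V} := [set xy in setX U W | f xy.1 xy.2].
have sub : [set xy : V * V | e xy.1 xy.2] \subset
    (E (~: cover P) [set: V] :|: E [set: V] (~: cover P)) :|:
    (\bigcup_(A in P) E A A :|: \bigcup_(AB in linked_pairs P) E AB.1 AB.2).
  apply/subsetP=> -[x y]; rewrite inE /= => xy.
  have [xc|xc] := boolP (x \in cover P); last by rewrite !in_setU !inE xc (ef _ _ xy).
  have [yc|yc] := boolP (y \in cover P); last by rewrite !in_setU !inE yc (ef _ _ xy) !orbT.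
  have xA : x \in pblock P x by rewrite mem_pblock.
  have yA : y \in pblock P y by rewrite mem_pblock.
  rewrite in_setU; apply/orP; right; rewrite in_setU.
  have [E1|ne] := eqVneq (pblock P x) (pblock P y).
    apply/orP; left; apply/bigcupP; exists (pblock P x); first exact: pblock_mem.
    by rewrite !inE /= xA E1 yA ef.
  apply/orP; right; apply/bigcupP; exists (pblock P x, pblock P y).
    rewrite !inE /= !pblock_mem // ne /=; apply/has_edgeP.
    by exists x, y.
  by rewrite !inE /= xA yA ef.
apply: leq_trans (subset_leq_card sub) _.
apply: leq_trans (leq_card_setU _ _) _; rewrite -addnA; apply: leq_add.
  apply: leq_trans (leq_card_setU _ _) _.
  by rewrite mul2n -addnn leq_add2l -/(pair_count f [set: V] _) pair_countC.
apply: leq_trans (leq_card_setU _ _) _.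
by apply: leq_add; apply: card_bigcup_leq.
Qed.

End EdgeDistribution.

Lemma num_edges_bin (V : finType) (F : sgraph V) : (num_edges F <= 'C(#|V|, 2)).
Proof.
rewrite -card_draws; apply/subset_leq_card/subsetP=> E EF; rewrite inE.
exact: (forall_inP (edges_card2 F) _ EF).
Qed.

Lemma ex_n_bin (W : finType) n (H : sgraph W) : (ex_n n H <= 'C(n, 2)).
Proof.
apply/bigmax_leqP=> F _; apply: leq_trans (num_edges_bin F) _.
by rewrite card_ord.
Qed.

(** * From a dense reduced graph to a cycle *)

(** Clusters shrunk by about a [1 / (20 * K)] part still give a blow-up denser than the extremal
    number, the term [#|V| ^ 2] paying for the shrinking. The resulting closed walk leaves
    [(4 * K + 60) * tau] vertices of each full cluster to spare, as the embedding requires. *)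
Lemma cycle_in_dense_reduced_graph (V : finType) (F : sgraph V) P (K N m r t : nat) :
  let tau := (m %/ (40 * K * (4 * K + 60))).+1 in
  (1 < K) -> (0 < N) -> trivIset P -> {in P, forall B : {set V}, #|B| = m} ->
  (#|P| <= N <= tau) -> (40 * K * (4 * K + 61) <= m) ->
  (K ^ r.-1 <= tau <= K ^ r) -> (2 * r + 4 + 2 * N <= t) ->
  (20 * K * ex_n #|V| (cycle_graph t) + #|V| ^ 2 <
     10 * K * (#|joined_pairs (adj F) tau P| * m ^ 2)) ->
  has_copy F (cycle_graph t).
Proof.
move=> tau K1 N0 tP cP /andP[PN Ntau] hm hr ht dense.
pose I : finType := {X : {set V} | X \in P}.
have cI : #|I| = #|P| by rewrite card_sig.
pose rel_I (X Y : I) := (val X != val Y) && joined (adj F) tau (val X) (val Y).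
have rsym : symmetric rel_I.
  move=> X Y; rewrite /rel_I eq_sym; congr (_ && _).
  by apply/idP/idP; apply: joined_sym; apply: adj_sym.
have rirr : irreflexive rel_I by move=> X; rewrite /rel_I eqxx.
have Idisj (X Y : I) x : x \in val X -> x \in val Y -> X = Y.
  move=> xX xY; apply: val_inj.
  by rewrite -(def_pblock tP (valP X) xX) (def_pblock tP (valP Y) xY).
pose d := (m %/ (20 * K)).
have d20 : (20 * K * d <= m) by rewrite mulnC leq_divM.
have K20 : (0 < 20 * K) by move: K1; clear; lia.
have dm : (d <= m) by apply: leq_trans d20; rewrite leq_pmull.
have /fin_all_exists[X' X'P] : forall X : I, exists S : {set V}, S \subset val X /\ #|S| = (m - d).
  move=> X; have [|S SX cS] := @exists_subset_card _ (val X) (m - d).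
    by rewrite (cP _ (valP X)) leq_subr.
  by exists S.
have X'disj (X Y : I) x : x \in X' X -> x \in X' Y -> X = Y.
  move=> xX xY; apply: (Idisj X Y x); first exact: (subsetP (X'P X).1).
  exact: (subsetP (X'P Y).1).
have cJ : (#|joined_pairs (adj F) tau P| <= #|[set ij : I * I | rel_I ij.1 ij.2]|).
  apply: leq_trans (leq_imset_card (fun ij : I * I => (val ij.1, val ij.2)) _).
  apply/subset_leq_card/subsetP=> -[A B]; rewrite !inE /= => /andP[/andP[AP BP] AB].
  by apply/imsetP; exists (Sub A AP, Sub B BP); rewrite ?inE /= ?SubK.
have JP : (#|joined_pairs (adj F) tau P| * m ^ 2 <= #|V| ^ 2).
  apply: (@leq_trans ((#|P| * m) ^ 2)).
    rewrite expnMn leq_mul2r; apply/orP; right.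
    rewrite -mulnn -cardsX; apply/subset_leq_card/subsetP=> AB.
    by rewrite inE => /andP[].
  by rewrite -(card_cover_uniform tP cP) leq_sqr max_card.
have t1 : (1 < t) by move: ht N0; clear; lia.
have dense' : (2 * ex_n #|V| (cycle_graph t) <
    #|[set ij : I * I | rel_I ij.1 ij.2]| * (m - d) ^ 2).
  apply: (@leq_trans (#|joined_pairs (adj F) tau P| * (m - d) ^ 2)); last by rewrite leq_mul2r cJ orbT.
  set J := #|joined_pairs _ _ _| in dense JP *.
  have : (10 * K * (J * m ^ 2) <= 10 * K * (J * (m - d) ^ 2) + J * m ^ 2).
    have h : (20 * K * d * m * J <= m * m * J) by rewrite !leq_mul2r d20 !orbT.
    have h2 : (m ^ 2 <= (m - d) ^ 2 + 2 * d * m).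
      have aux u v : (u + v) ^ 2 <= u ^ 2 + 2 * v * (u + v) by clear; nia.
      by have := aux (m - d) d; rewrite subnK.
    have h3 : (10 * K * (J * m ^ 2) <= 10 * K * (J * ((m - d) ^ 2 + 2 * d * m))).
      by rewrite !leq_mul2l h2 !orbT.
    apply: leq_trans h3 _; rewrite !mulnDr leq_add2l.
    by move: h; rewrite -mulnn; clear; nia.
  move=> h; have K10 : 0 < 10 * K by move: K1; clear; lia.
  rewrite -(ltn_pmul2l K10).
  have -> : 10 * K * (2 * ex_n #|V| (cycle_graph t)) = 20 * K * ex_n #|V| (cycle_graph t).
    by rewrite mulnA (mulnC _ 2) mulnA.
  by move: h dense JP; clear; lia.
have [c [cR cD]] := dense_blow_up_walk rsym rirr X'disj (fun X => (X'P X).2) t1 dense'.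
have I0 : (0 < #|I|).
  by apply/card_gt0P; exists (c (Ordinal (ltnW t1))).
have [C [<- uC cC]] : exists C : seq V, [/\ size C = t, uniq C & cycle (adj F) C].
  apply: (@blow_up_cycle V I (adj F) rel_I (fun X => val X) _ _ rsym Idisj m (m - d) tau K r t c) => //.
  - exact: adj_sym.
  - exact: adj_irr.
  - by move=> X; apply: cP; apply: valP.
  - by move=> X Y /andP[].
  - by rewrite I0 cI (leq_trans PN).
  - by rewrite subn_gt0; move: d20 K20 hm K1; clear; nia.
  - have le_d : (4 * K + 60) * tau <= d.
      rewrite leqNgt; apply/negP=> h.
      have := leq_divM m (40 * K * (4 * K + 60)); have := ltn_ceil m K20; rewrite -/d.
      move: h; rewrite /tau; move: (m %/ (40 * K * (4 * K + 60))) => q h h1 h2.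
      have : 40 * K * d.+1 <= 40 * K * ((4 * K + 60) * q.+1) by rewrite leq_mul2l h orbT.
      by move: h1 h2 hm; clear; nia.
    by move: le_d dm; clear; lia.
  - by apply: leq_trans ht; rewrite cI leq_add2l leq_mul2l PN.
exact: cycle_has_copy.
Qed.

Import Order.TTheory GRing.Theory Num.Theory.
Local Open Scope ring_scope.

(** * Consequences of upper-uniformity *)

Section UpperUniform.

Variables (R : realType) (V : finType) (G : sgraph V) (p eta : R) (s : nat).
Hypotheses (p0 : 0 < p) (eta1 : eta <= 1) (uuG : upper_uniform p eta G).
Hypotheses (hs : eta * #|V|%:R <= s%:R) (s2 : (2 * s <= #|V|)%N).

Lemma upper_uniform_pair (X Y : {set V}) :
  [disjoint X & Y] -> (s <= #|X|)%N -> (s <= #|Y|)%N ->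
  (pair_count (adj G) X Y)%:R <= (1 + eta) * p * #|X|%:R * #|Y|%:R :> R.
Proof.
by move=> dis sX sY; apply: uuG => //; apply: (le_trans hs); rewrite ler_nat.
Qed.

(** Upper-uniformity only speaks of large disjoint sets. A large cut of [S] reduces the count to a
    disjoint pair, which is enlarged to sets of exactly [s] vertices; the constant comes from
    [4 * (1 + eta) <= 8]. *)
Lemma upper_uniform_inside (S : {set V}) : (#|S| <= s)%N ->
  (pair_count (adj G) S S)%:R <= 8 * p * s%:R ^+ 2 :> R.
Proof.
move=> cS; have [S1 S1S cut] := max_cut (@adj_sym V G) S (@adj_irr V G).
have c1 : (#|S1| <= s)%N by apply: leq_trans cS; apply: subset_leq_card.
have c2 : (#|S :\: S1| <= s)%N by apply: leq_trans cS; apply/subset_leq_card/subsetDl.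
have [|||U [S1U US cU]] := @exists_superset_card _ S1 (~: (S :\: S1)) s => //.
  by apply/subsetP=> x xS; rewrite !inE xS.
  by have := cardsC (S :\: S1); move: c2 s2; clear; lia.
have [|||W [SW WU cW]] := @exists_superset_card _ (S :\: S1) (~: U) s => //.
  by rewrite -[S :\: S1]setCK setCS.
  by have := cardsC U; rewrite cU; move: s2; clear; lia.
have dUW : [disjoint U & W] by rewrite disjoint_sym disjoints_subset.
have := upper_uniform_pair dUW; rewrite cU cW => /(_ (leqnn _) (leqnn _)) hUW.
have mono := pair_countS (adj G) S1U SW.
have h4 : (pair_count (adj G) S S)%:R <= 4 * (pair_count (adj G) U W)%:R :> R.
  by rewrite -natrM ler_nat; apply: leq_trans cut _; rewrite leq_mul2l mono orbT.
apply: le_trans h4 _; apply: (@le_trans _ _ (4 * ((1 + eta) * p * s%:R * s%:R))).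
  by rewrite ler_pM2l.
have -> : 4 * ((1 + eta) * p * s%:R * s%:R) = (1 + eta) * (4 * p * s%:R ^+ 2) by ring.
have -> : 8 * p * s%:R ^+ 2 = 2 * (4 * p * s%:R ^+ 2) by ring.
apply: ler_wpM2r; last by move: eta1; lra.
by rewrite !mulr_ge0 // ?ltW // exprn_ge0.
Qed.

Lemma upper_uniform_touching (S : {set V}) : (#|S| <= s)%N ->
  (pair_count (adj G) S [set: V])%:R <= 8 * p * s%:R ^+ 2 + 2 * p * s%:R * #|V|%:R :> R.
Proof.
move=> cS; have [|||U [SU _ cU]] := @exists_superset_card _ S [set: V] s => //.
  by rewrite cardsT; move: s2; clear; lia.
apply: (@le_trans _ _ (pair_count (adj G) U [set: V])%:R).
  by rewrite ler_nat; apply: pair_countS.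
rewrite -(setUCr U) pair_countC; last exact: adj_sym.
rewrite pair_countU ?disjoints_subset ?setCK // natrD; apply: lerD.
  by apply: upper_uniform_inside; rewrite cU.
have cUC := cardsC U; rewrite cU in cUC.
rewrite pair_countC; last exact: adj_sym.
have := @upper_uniform_pair U (~: U); rewrite disjoints_subset setCK cU.
move=> /(_ (subxx _) (leqnn _)) h.
apply: le_trans (h _) _; first by move: cUC s2; clear; lia.
apply: (@le_trans _ _ (2 * p * s%:R * #|~: U|%:R)).
  by rewrite !ler_wpM2r ?ler0n ?(ltW p0) //; move: eta1; lra.
by rewrite ler_wpM2l ?ler_nat ?max_card // !mulr_ge0 ?ler0n ?(ltW p0).
Qed.

End UpperUniform.

Lemma num_edges_upper (R : realType) (V : finType) (F G : sgraph V) (p eta : R)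
    (P : {set {set V}}) (m s : nat) :
  0 < p -> eta <= 1 -> upper_uniform p eta G -> edges F \subset edges G ->
  trivIset P -> {in P, forall B : {set V}, #|B| = m} ->
  eta * #|V|%:R <= m%:R -> (m <= s)%N -> (2 * s <= #|V|)%N -> (#|~: cover P| <= s)%N ->
  (2 * num_edges F)%N%:R <= p * ((1 + eta) * #|linked_pairs (adj F) P|%:R * m%:R ^+ 2
     + 8 * #|P|%:R * m%:R ^+ 2 + 16 * s%:R ^+ 2 + 4 * s%:R * #|V|%:R).
Proof.
move=> p0 eta1 uuG FG tP cP hm ms s2 cC.
have hs : eta * #|V|%:R <= s%:R by apply: le_trans hm _; rewrite ler_nat.
have m2 : (2 * m <= #|V|)%N by move: ms s2; clear; lia.
have FGr : subrel (adj F) (adj G) by move=> x y; apply: (subsetP FG).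
have := edge_distribution P (@adj_sym V G) FGr; rewrite card_adj => h.
apply: (@le_trans _ _ (2 * pair_count (adj G) (~: cover P) [set: V] +
    \sum_(A in P) pair_count (adj G) A A +
    \sum_(AB in linked_pairs (adj F) P) pair_count (adj G) AB.1 AB.2)%N%:R).
  by rewrite ler_nat.
have h1 := upper_uniform_touching p0 eta1 uuG hs s2 cC.
have h2 : (\sum_(A in P) pair_count (adj G) A A)%N%:R <= #|P|%:R * (8 * p * m%:R ^+ 2) :> R.
  rewrite natr_sum mulr_natl -sumr_const; apply: ler_sum => A AP.
  by apply: (upper_uniform_inside p0 eta1 uuG hm m2); rewrite cP.
have h3 : (\sum_(AB in linked_pairs (adj F) P) pair_count (adj G) AB.1 AB.2)%N%:R <=
    #|linked_pairs (adj F) P|%:R * ((1 + eta) * p * m%:R * m%:R) :> R.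
  rewrite natr_sum mulr_natl -sumr_const; apply: ler_sum => -[A B].
  rewrite !inE /= => /andP[/andP[AP BP] /andP[AB _]].
  have dAB : [disjoint A & B] by move/trivIsetP: tP; apply.
  have := upper_uniform_pair uuG hm dAB; rewrite !cP //; exact.
rewrite natrD natrD natrM.
have -> : p * ((1 + eta) * #|linked_pairs (adj F) P|%:R * m%:R ^+ 2
     + 8 * #|P|%:R * m%:R ^+ 2 + 16 * s%:R ^+ 2 + 4 * s%:R * #|V|%:R) =
  2 * (8 * p * s%:R ^+ 2 + 2 * p * s%:R * #|V|%:R) + #|P|%:R * (8 * p * m%:R ^+ 2) +
  #|linked_pairs (adj F) P|%:R * ((1 + eta) * p * m%:R * m%:R) by ring.
by apply: lerD h3; apply: lerD h2; rewrite ler_pM2l.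
Qed.

(** * Numerical estimates and the choice of parameters *)

(** Pure arithmetic: [x] stands for the extremal number, [c] for the number of vertex pairs, and
    [j], [b], [k], [L] for the numbers of joined pairs, bad pairs, clusters and linked pairs. The
    surplus [beta] outweighs all error terms because [1 <= K * beta]. *)
Lemma reduced_density (R : realType) (beta p eta n x c eG eF j b k L m s K : R) :
  0 < beta -> beta < 1 / 5 -> 1 <= K * beta -> 0 < K -> 0 < p -> 0 < c -> 0 <= m -> 0 <= s -> 0 <= n ->
  0 <= x -> 0 <= k -> 0 <= L ->
  2 * eF <= p * ((1 + eta) * L * m ^+ 2 + 8 * k * m ^+ 2 + 16 * s ^+ 2 + 4 * s * n) ->
  (x / c + beta) * eG < eF -> (1 - beta / 2) * p * c <= eG -> x <= c -> n ^+ 2 <= 4 * c ->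
  k * m <= n -> L <= k ^+ 2 -> L <= j + b -> 60 * K * b <= k ^+ 2 -> 840 * K * m <= n ->
  840 * K * s <= n -> 0 <= eta -> 30 * K * eta <= 1 -> s <= n ->
  20 * K * x + n ^+ 2 < 10 * K * (j * m ^+ 2).
Proof.
move=> be0 be5 Kbe K0 p0 c0 m0 s0 n0 x0 k0 L0 up low eGc xc nc km Lk Lj bK mK sK eta0 etaK sn.
(* The core is [(2 - beta) * (x + beta * c) >= 2 * x + 4 / 5 * beta * c], from [x <= c] and
   [beta < 1 / 5]. *)
have lower : p * (2 * x + 4 / 5 * beta * c) < 2 * eF.
  apply: (@le_lt_trans _ _ (2 * ((x / c + beta) * eG))); last by rewrite ltr_pM2l.
  apply: (@le_trans _ _ (2 * ((x / c + beta) * ((1 - beta / 2) * p * c)))); last first.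
    rewrite ler_pM2l // ler_wpM2l // addr_ge0 ?divr_ge0 // ltW //.
  have -> : 2 * ((x / c + beta) * ((1 - beta / 2) * p * c)) =
    p * ((2 - beta) * (x + beta * c)).
    by field; rewrite gt_eqF.
  rewrite ler_pM2l //; have : beta * x <= beta * c by rewrite ler_wpM2l // ltW.
  have : 0 <= beta * c * (1 / 5 - beta) by rewrite !mulr_ge0 ?ltW // subr_gt0.
  lra.
have main : 2 * x + 4 / 5 * beta * c <
    (1 + eta) * L * m ^+ 2 + 8 * k * m ^+ 2 + 16 * s ^+ 2 + 4 * s * n.
  by rewrite -(ltr_pM2l p0); apply: lt_le_trans up.
have km2 : k ^+ 2 * m ^+ 2 <= n ^+ 2.
  by rewrite -exprMn ler_sqr ?nnegrE ?mulr_ge0.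
have m20 : 0 <= m ^+ 2 by rewrite exprn_ge0.
have Lm : L * m ^+ 2 <= n ^+ 2 by apply: le_trans km2; rewrite ler_wpM2r.
have t1 : 60 * K * (b * m ^+ 2) <= n ^+ 2.
  by apply: le_trans km2; rewrite mulrA ler_wpM2r.
have t2 : 30 * K * (eta * (L * m ^+ 2)) <= n ^+ 2.
  apply: le_trans Lm; rewrite mulrA -[leRHS]mul1r ler_wpM2r // mulr_ge0 //.
have t3 : 840 * K * (k * m ^+ 2) <= n ^+ 2.
  have -> : 840 * K * (k * m ^+ 2) = (k * m) * (840 * K * m) by ring.
  rewrite expr2; apply: ler_pM => //; rewrite ?mulr_ge0 // ltW //.
have t4 : 840 * K * s ^+ 2 <= n ^+ 2.
  have -> : 840 * K * s ^+ 2 = s * (840 * K * s) by ring.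
  by rewrite expr2; apply: ler_pM => //; rewrite ?mulr_ge0 // ltW.
have t5 : 840 * K * (s * n) <= n ^+ 2.
  by rewrite mulrA expr2 ler_wpM2r.
have t6 : L * m ^+ 2 <= j * m ^+ 2 + b * m ^+ 2 by rewrite -mulrDl ler_wpM2r.
have t7 : n ^+ 2 <= 4 * (K * (beta * c)).
  by apply: le_trans nc _; rewrite ler_pM2l // mulrA ler_peMl // ltW.
have mainK : K * (2 * x + 4 / 5 * beta * c) <
    K * ((1 + eta) * L * m ^+ 2 + 8 * k * m ^+ 2 + 16 * s ^+ 2 + 4 * s * n).
  by rewrite ltr_pM2l.
have t6K : K * (L * m ^+ 2) <= K * (j * m ^+ 2 + b * m ^+ 2) by rewrite ler_pM2l.
have n2 : 0 <= n ^+ 2 by rewrite exprn_ge0.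
(* After scaling by 10 the surplus is [8 * K * beta * c >= 2 * n ^ 2], while the error terms add up
   to at most [5 / 6 * n ^ 2]. *)
move: mainK t6K t1 t2 t3 t4 t5 t7 n2; clear.
lra.
Qed.

(** The constant 3 is 2 + 1: [K ^ r.-1 < tau <= n] bounds [2 * r.-1] by twice
    [ln n / ln (1 / beta)], and [K ^ (6 + 2 * N) <= n] bounds the rest by once that quantity. *)
Lemma logarithmic_depth (R : realType) (beta : R) (K N n t tau : nat) :
  0 < beta -> beta < 1 -> 1 / beta <= K%:R -> (1 < K)%N -> (1 < tau)%N -> (tau <= n)%N ->
  (K ^ (6 + 2 * N) <= n)%N ->
  3 / ln (1 / beta) * ln n%:R <= t%:R ->
  (2 * up_log K tau + 4 + 2 * N <= t)%N.
Proof.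
move=> be0 be1 beK K1 tau1 taun Kn ht.
set r := up_log K tau.
have r0 : (0 < r)%N by rewrite up_log_gt0 K1.
have ib1 : 1 < 1 / beta by rewrite ltr_pdivlMr // mul1r.
have L0 : 0 < ln (1 / beta) by apply: ln_gt0.
have KR0 : 0 < K%:R :> R by rewrite ltr0n; apply: ltn_trans K1.
have LK : ln (1 / beta) <= ln K%:R.
  by rewrite ler_ln ?posrE //; apply: lt_trans ib1.
have pow k : (K ^ k <= n)%N -> k%:R * ln (1 / beta) <= ln n%:R.
  move=> hk; apply: (@le_trans _ _ (k%:R * ln K%:R)); first by rewrite ler_wpM2l.
  rewrite mulr_natl -lnXn // -natrX ler_ln ?posrE ?ltr0n ?ler_nat //.
    by rewrite expn_gt0 (ltn_trans _ K1).
  by apply: leq_trans hk; rewrite expn_gt0 (ltn_trans _ K1).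
have h1 := pow _ Kn.
have h2 : (r.-1)%:R * ln (1 / beta) <= ln n%:R.
  apply: pow; apply: ltnW; apply: leq_trans taun; exact: up_log_gtn.
rewrite -(ler_nat R); apply: le_trans ht.
have -> : 3 / ln (1 / beta) * ln n%:R = 3 * ln n%:R / ln (1 / beta).
  by rewrite -mulrA [_^-1 * _]mulrC mulrA.
rewrite ler_pdivlMr //.
have -> : (2 * r + 4 + 2 * N)%N = (2 * r.-1 + (6 + 2 * N))%N by move: r0; clear; lia.
by rewrite natrD natrM; move: h1 h2; lra.
Qed.

Theorem corollary1p5 (R : realType) :
  exists C1 C2 : R, 0 < C1 /\ 0 < C2 /\
  forall beta : R, 0 < beta -> beta < 1 / 5 ->
  exists (eta : R) (n0 : nat), 0 < eta /\ eta <= 1 /\ (0 < n0)%N /\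
  forall n : nat, (n0 <= n)%N ->
  forall (V : finType) (G : sgraph V) (p : R), #|V| = n ->
    0 < p -> p <= 1 ->
    upper_uniform p eta G ->
    (1 - beta / 2) * p * ('C(n, 2))%:R <= (num_edges G)%:R ->
  forall t : nat,
    C1 / ln (1 / beta) * ln (n%:R) <= t%:R ->
    t%:R <= (1 - C2 * beta) * n%:R ->
    (ex_graph G (cycle_graph t))%:R <=
      ((ex_n n (cycle_graph t))%:R / ('C(n, 2))%:R + beta)
        * (num_edges G)%:R.
Proof.
exists 3, 1; do 2!split=> //; move=> beta be0 be5.
have ib5 : 5 < 1 / beta by rewrite ltr_pdivlMr // mulrC -ltr_pdivlMr // mul1r -[_^-1]mul1r.
(* [K] has two roles: the trees branch [K]-fold, which bounds their depth in terms of
   [ln n / ln (1 / beta)], and [1 / K] measures the errors against [beta]. *)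
have [K beK] : exists K : nat, 1 / beta <= K%:R.
  by exists (Num.bound (1 / beta)); apply/ltW/archi_boundP; apply: le_trans (ltW ib5).
have K5 : (5 < K)%N by rewrite -(ltr_nat R); apply: lt_le_trans beK.
have K1 : (1 < K)%N by apply: leq_trans K5.
have KR0 : 0 < K%:R :> R by rewrite ltr0n; apply: leq_trans K5.
pose a := (40 * K * (4 * K + 60))%N.
(* [a] fixes the ratio of [m] to [tau], [60 * K] limits the bad pairs, and [840 * K] limits both the
   cluster size and the uncovered remainder. *)
have [|||N [N0 reg]] := @hole_regularity a (60 * K) (840 * K).
- by rewrite /a; move: K5; clear; nia.
- by move: K5; clear; lia.
- by move: K5; clear; lia.
(* Clusters have at least [#|V| / N] vertices, so upper-uniformity applies to them; the factor
   [30 * K] makes [eta] small as an error term. *)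
pose eta : R := (30 * K * N)%N%:R^-1.
have KN : (0 < 30 * K * N)%N by rewrite !muln_gt0 N0 (leq_trans _ K5).
have eta0 : 0 < eta by rewrite invr_gt0 ltr0n.
have eta1 : eta <= 1 by rewrite invf_le1 ?ltr0n // ler1n.
(* The summands provide, in turn, for the regularity partition, for large [m], for [N < tau], for
   the depth estimate and for [n >= 3]. *)
pose n0 := (N + N * (40 * K * (4 * K + 61)) + N * (a * N.+1) + K ^ (6 + 2 * N) + 3)%N.
exists eta, n0; do 3!split=> //; first by rewrite /n0 addn3.
move=> n hn V G p cV p0 p1 uuG eG t ht _; subst n.
have [hn1 hn2 hn3 hn4] : [/\ (N <= #|V|)%N, (N * (40 * K * (4 * K + 61)) <= #|V|)%N,
    (N * (a * N.+1) <= #|V|)%N & (K ^ (6 + 2 * N) <= #|V|)%N].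
  by split; move: hn; rewrite /n0; clear; lia.
have n3 : (3 <= #|V|)%N by move: hn; rewrite /n0; clear; lia.
have c0 : (0 < 'C(#|V|, 2))%N by rewrite bin_gt0 ltnW.
have B0 : 0 <= ((ex_n #|V| (cycle_graph t))%:R / ('C(#|V|, 2))%:R + beta) * (num_edges G)%:R :> R.
  by rewrite mulr_ge0 ?addr_ge0 ?divr_ge0 ?ler0n // ltW.
rewrite /ex_graph; elim/big_ind: _ => [//|x y hx hy|F /andP[FG nocopy]].
  by rewrite /maxn; case: ifP.
rewrite leNgt; apply: contra nocopy => dense.
(* The partition is made for [F]; [G] enters only through its edge counts. *)
have [P [m [tP cP Nm Am [AC gb]]]] := reg V (adj F) hn1.
set tau := (m %/ a).+1 in gb.
have mV : (m <= #|V|)%N by apply: leq_trans Am; rewrite leq_pmull // muln_gt0 (leq_trans _ K5).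
have m0 : (0 < m)%N.
  by rewrite lt0n; apply: contraTneq n3 => Em; move: Nm; rewrite Em muln0 leqn0 => /eqP->.
have PN : (#|P| <= N)%N.
  rewrite -(leq_pmul2r m0) -(card_cover_uniform tP cP); apply: leq_trans Nm; exact: max_card.
have mbig : (40 * K * (4 * K + 61) <= m)%N.
  by rewrite -(leq_pmul2l N0); apply: leq_trans Nm.
have a0 : (0 < a)%N by rewrite /a; move: K5; clear; nia.
have Ntau : (N < tau)%N.
  by rewrite /tau ltnS leq_divRL // -(leq_pmul2l N0); apply: leq_trans Nm; apply: leq_trans hn3;
     rewrite leq_mul2l mulnC leq_mul2l leqnSn !orbT.
have tau1 : (1 < tau)%N by apply: leq_trans Ntau.
have taun : (tau <= #|V|)%N.
  apply: leq_trans mV; apply: ltn_Pdiv => //.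
  by rewrite /a; move: K5; clear; nia.
apply: (@cycle_in_dense_reduced_graph V F P K N m (up_log K tau) t) => //.
- by rewrite PN ltnW.
- by rewrite up_logP // andbT ltnW // up_log_gtn.
- by apply: (@logarithmic_depth R beta K N #|V|) => //; apply: lt_trans be5 _; lra.
rewrite -/a -/tau.
pose s := (#|V| %/ (840 * K))%N.
have K840 : (0 < 840 * K)%N by move: K5; clear; lia.
have sV : (840 * K * s <= #|V|)%N by rewrite mulnC leq_divM.
have ms : (m <= s)%N by rewrite /s leq_divRL // mulnC.
have Cs : (#|~: cover P| <= s)%N by rewrite /s leq_divRL // mulnC.
have s2 : (2 * s <= #|V|)%N by apply: leq_trans sV; rewrite leq_mul2r; apply/orP; right; move: K5; clear; lia.
have etam : eta * #|V|%:R <= m%:R.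
  rewrite /eta mulrC ler_pdivrMr ?ltr0n // -natrM ler_nat; apply: leq_trans Nm _.
  by rewrite mulnC leq_mul2l leq_pmull ?orbT // muln_gt0 (leq_trans _ K5).
have up := num_edges_upper p0 eta1 uuG FG tP cP etam ms s2 Cs.
rewrite natrM in up.
rewrite -(ltr_nat R) natrD (natrX _ #|V|) (natrM _ (20 * K)%N) (natrM _ 20).
rewrite (natrM _ (10 * K)%N) (natrM _ 10) (natrM _ #|joined_pairs _ _ _|) (natrX _ m).
apply: (@reduced_density R beta p eta #|V|%:R (ex_n #|V| (cycle_graph t))%:R
  ('C(#|V|, 2))%:R (num_edges G)%:R (num_edges F)%:R #|joined_pairs (adj F) tau P|%:R
  #|bad_pairs (adj F) tau P|%:R #|P|%:R #|linked_pairs (adj F) P|%:R m%:R s%:R K%:R) => //.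
- by rewrite -ler_pdivrMr.
- by rewrite ltr0n.
- by rewrite ler_nat ex_n_bin.
- rewrite -natrX -natrM ler_nat bin2; move: n3; clear.
  by move: #|V| => n; nia.
- by rewrite -natrM ler_nat -(card_cover_uniform tP cP) max_card.
- rewrite -natrX ler_nat -mulnn -cardsX; apply/subset_leq_card/subsetP=> AB.
  by rewrite inE => /andP[].
- by rewrite -natrD ler_nat card_linked_pairs.
- by rewrite -natrX -!natrM ler_nat.
- by rewrite -!natrM ler_nat.
- by rewrite -!natrM ler_nat.
- exact: ltW.
- rewrite /eta -!natrM ler_pdivrMr ?ltr0n // mul1r ler_nat leq_pmulr //.
- by rewrite ler_nat; apply: leq_trans s2; rewrite leq_pmull.
Qed.
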